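(* There exists a constant $C$ depending only on $d,n$ such that the following holds. For every $f_1,f_2\in L^1(\mathbb{R}^d;\mathbb{R}^n)$ with compact support and every dyadic lattice $\mathcal D$ of $\mathbb{R}^d$ there exists a sparse collection $\mathcal S_{\mathcal D}\subset\mathcal D$ such that for all integers $\varrho\ge1$ \[ \sup_{\mathbb S^\varrho}|\mathbb S^\varrho\otimes\mathrm{Id}_{\mathbb{R}^n}(f_1,f_2)|\leq C\varrho\sum_{Q\in\mathcal S_{\mathcal D}}|Q|\langle f_1\rangle_Q\langle f_2\rangle_Q, \] the supremum being taken over all dyadic shifts $\mathbb S^\varrho$ of complexity $\varrho$ constructed on $\mathcal D$.
   Context: Dyadic shift: for a dyadic lattice $\mathcal D$ and nonnegative integers $m_1,m_2$, a bilinear form $\mathbb S^\varrho(f_1,f_2)=\sum_{Q\in\mathcal D}\int_{Q\times Q}s_Q(x_1,x_2)f_1(x_1)f_2(x_2)\,dx_1dx_2$ on scalar functions with $\varrho=\max\{1,m_1,m_2\}$, such that (A1) $s_Q$ vanishes for all but finitely many $Q$ and $\|s_Q\|_\infty\le|Q|^{-1}$; (A2) for every subcollection $\mathcal Q\subset\mathcal D$ the partial sum over $Q\in\mathcal Q$ is bounded in absolute value by $\|f_1\|_2\|f_2\|_2$; (A3) if $R\in\mathcal D$, $R\subset Q$, $\ell(R)<2^{-m_1}\ell(Q)$ then $s_Q(\cdot,x_2)$ is constant on $R$ for all $x_2\in Q$, and symmetrically (with $m_2$) in the other variable. For $\mathbb{R}^n$-valued $f_1,f_2$ with coordinates $f_{i,j}$,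 $\mathbb S^\varrho\otimes\mathrm{Id}_{\mathbb{R}^n}(f_1,f_2):=\sum_{j=1}^n\mathbb S^\varrho(f_{1,j},f_{2,j})$. For a cube $Q$ let $\Phi(Q)$ be the set of real functions $\varphi$ on $\mathbb{R}^d$ with $\|\varphi\|_\infty\le1$ and support in $Q$; for $f\in L^1_{\mathrm{loc}}(\mathbb{R}^d;\mathbb{R}^n)$, $\langle f\rangle_Q:=\{\frac1{|Q|}\int f\varphi\,dx:\varphi\in\Phi(Q)\}\subset\mathbb{R}^n$, a closed convex symmetric set. For closed convex symmetric sets $K,H\subset\mathbb{R}^n$, $KH$ denotes the right endpoint of the interval $\{k\cdot h:k\in K,h\in H\}$ (i.e. $\sup_{k\in K,h\in H}k\cdot h$). A collection $\mathcal S$ of cubes is sparse if for a fixed $\eta\in(0,1)$ each $Q\in\mathcal S$ contains $E_Q$ with $|E_Q|\ge\eta|Q|$ and the $E_Q$ are pairwise disjoint. *)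

(* Defs.v *)
From HB Require Import structures.
From mathcomp Require Import all_boot all_order all_algebra.
From mathcomp Require Import all_classical all_reals all_analysis.
Import Order.TTheory GRing.Theory Num.Theory.
Import numFieldNormedType.Exports.

Set Implicit Arguments.
Unset Strict Implicit.
Unset Printing Implicit Defensive.

Local Open Scope classical_set_scope.
Local Open Scope ring_scope.

Section ProdSF.
Context d1 d2 (T1 : measurableType d1) (T2 : measurableType d2) (R : realType).
Variables (m1 : {sigma_finite_measure set T1 -> \bar R})
          (m2 : {sigma_finite_measure set T2 -> \bar R}).
Local Open Scope ereal_scope.

Lemma prod_sigma_finite : sigma_finite setT (m1 \x m2).
Proof.
have /sigma_finiteP[F [TF ndF Foo]] := sigma_finiteT m1.
have /sigma_finiteP[G [TG ndG Goo]] := sigma_finiteT m2.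
exists (fun n => F n `*` G n).
 rewrite -setXTT TF TG predeqE => -[x y]; split.
    move=> [/= [n _ Fnx] [k _ Gky]]; exists (maxn n k) => //; split.
    - by move: x Fnx; exact/subsetPset/ndF/leq_maxl.
    - by move: y Gky; exact/subsetPset/ndG/leq_maxr.
  by move=> [n _ []/= ? ?]; split; exists n.
move=> k; have [? ?] := Foo k; have [? ?] := Goo k.
split; first exact: measurableX.
by rewrite product_measure1E// lte_mul_pinfty// ge0_fin_numE.
Qed.

Definition prodSF : {sigma_finite_measure set (T1 * T2)%type -> \bar R} :=
  HB.pack (m1 \x m2) (Measure_isSigmaFinite.Build _ _ _ (m1 \x m2) prod_sigma_finite).
End ProdSF.

Section Euclid.
Variable R : realType.

Definition dR : measure_display := ltac:(
  let T := constr:(measurableTypeR R : measurableType _) in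
  match type of T with Measurable.type ?d => exact d end).

Fixpoint Rdisp (k : nat) : measure_display :=
  match k with 0 => dR | k.+1 => (dR, Rdisp k).-prod end.

(** RDt k is R^(k+1) *)
Fixpoint RDt (k : nat) : measurableType (Rdisp k) :=
  match k return measurableType (Rdisp k) with
  | 0 => measurableTypeR R
  | k.+1 => (measurableTypeR R * RDt k)%type
  end.

Definition lebR : {sigma_finite_measure set (measurableTypeR R) -> \bar R} :=
  [the {sigma_finite_measure set _ -> \bar R} of @lebesgue_measure R].

Fixpoint lebRD (k : nat) : {sigma_finite_measure set (RDt k) -> \bar R} :=
  match k return {sigma_finite_measure set (RDt k) -> \bar R} with
  | 0 => lebR
  | k.+1 => prodSF lebR (lebRD k)
  end.

Fixpoint coordRD (k : nat) : RDt k -> nat -> R :=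
  match k return RDt k -> nat -> R with
  | 0 => fun x _ => x
  | k.+1 => fun x i => if i is i'.+1 then coordRD x.2 i' else x.1
  end.

(** R^d, meaningful for d >= 1 *)
Definition Rsp (d : nat) : measurableType (Rdisp d.-1) := RDt d.-1.
Definition leb (d : nat) : {sigma_finite_measure set (Rsp d) -> \bar R} :=
  lebRD d.-1.
Definition coord (d : nat) (x : Rsp d) (i : 'I_d) : R := coordRD x i.
(** the point as a row vector of 'rV[R]_d (used for topology) *)
Definition rowv (d : nat) (x : Rsp d) : 'rV[R]_d := \row_i coord x i.

Record cube (d : nat) := Cube { corner : 'I_d -> R ; side : R }.
HB.instance Definition _ d := gen_eqMixin (cube d).
HB.instance Definition _ d := gen_choiceMixin (cube d).

Definition cubeset (d : nat) (Q : cube d) : set (Rsp d) :=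
  [set x | forall i, corner Q i <= coord x i < corner Q i + side Q].
Definition cubeV (d : nat) (Q : cube d) : set 'rV[R]_d :=
  [set v | forall i, corner Q i <= v ord0 i < corner Q i + side Q].
Definition vol (d : nat) (Q : cube d) : R := side Q ^+ d.

(** Q' is obtained from Q by k successive dyadic subdivisions *)
Definition descendant (d : nat) (k : nat) (Q' Q : cube d) : Prop :=
  side Q' = side Q / 2 ^+ k /\
  forall i, exists m : nat, (m < 2 ^ k)%N /\
    corner Q' i = corner Q i + m%:R * side Q'.

(** dyadic lattice (Lerner--Nazarov) *)
Definition dyadic_lattice (d : nat) (D : set (cube d)) : Prop :=
  [/\ forall Q, D Q -> 0 < side Q,
      forall Q Q', D Q -> descendant 1 Q' Q -> D Q',
      forall Q1 Q2, D Q1 -> D Q2 -> exists Q, D Q /\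
        (exists k, descendant k Q1 Q) /\ (exists k, descendant k Q2 Q) &
      forall K : set 'rV[R]_d, compact K -> exists Q, D Q /\ K `<=` cubeV Q].

Definition sparse (d : nat) (eta : R) (S : set (cube d)) : Prop :=
  exists E : cube d -> set (Rsp d),
    (forall Q, S Q -> [/\ measurable (E Q), E Q `<=` cubeset Q &
                          ((eta * vol Q)%:E <= leb d (E Q))%E]) /\
    (forall Q Q', S Q -> S Q' -> Q <> Q' -> E Q `&` E Q' = set0).

Definition Phi (d : nat) (Q : cube d) : set (Rsp d -> R) :=
  [set phi : Rsp d -> R | [/\ measurable_fun setT phi, forall x, `|phi x| <= 1 &
                 forall x, ~ cubeset Q x -> phi x = 0]].

Definition avg (d n : nat) (f : Rsp d -> 'rV[R]_n) (Q : cube d) : set 'rV[R]_n :=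
  [set v | exists2 phi, Phi Q phi &
     v = \row_j ((vol Q)^-1 * Rintegral (leb d) setT (fun x => f x ord0 j * phi x))].

Definition setprod (n : nat) (K H : set 'rV[R]_n) : \bar R :=
  ereal_sup [set r | exists k h, [/\ K k, H h &
                                     r = (\sum_(j < n) k ord0 j * h ord0 j)%:E]].

Definition L1vec (d n : nat) (f : Rsp d -> 'rV[R]_n) : Prop :=
  forall j : 'I_n, (leb d).-integrable setT (fun x => (f x ord0 j)%:E).

Definition compact_support (d n : nat) (f : Rsp d -> 'rV[R]_n) : Prop :=
  exists K : set 'rV[R]_d, compact K /\ forall x, f x != 0 -> K (rowv x).

Definition L2 (d : nat) (g : Rsp d -> R) : Prop :=
  measurable_fun setT g /\ (\int[leb d]_x ((g x) ^+ 2)%:E < +oo)%E.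

Definition norm2 (d : nat) (g : Rsp d -> R) : R :=
  Num.sqrt (Rintegral (leb d) setT (fun x => g x ^+ 2)).

Definition shift_form (d : nat) (s : cube d -> Rsp d -> Rsp d -> R)
    (Qs : set (cube d)) (g1 g2 : Rsp d -> R) : R :=
  \sum_(Q \in Qs) Rintegral (prodSF (leb d) (leb d)) (cubeset Q `*` cubeset Q)
                     (fun z => s Q z.1 z.2 * g1 z.1 * g2 z.2).

Definition dyadic_shift (d : nat) (D : set (cube d)) (m1 m2 : nat)
    (s : cube d -> Rsp d -> Rsp d -> R) : Prop :=
  [/\
      finite_set [set Q | D Q /\ exists x1 x2, [/\ cubeset Q x1, cubeset Q x2 &
                                                   s Q x1 x2 != 0]] /\
      (forall Q, D Q -> forall x1 x2, cubeset Q x1 -> cubeset Q x2 ->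
                   `|s Q x1 x2| <= (vol Q)^-1),
      forall Qs, Qs `<=` D -> forall g1 g2, L2 g1 -> L2 g2 ->
        `|shift_form s Qs g1 g2| <= norm2 g1 * norm2 g2 &
      forall Q Rc, D Q -> D Rc -> cubeset Rc `<=` cubeset Q ->
        (side Rc < side Q / 2 ^+ m1 ->
           forall x2, cubeset Q x2 -> forall x x', cubeset Rc x -> cubeset Rc x' ->
             s Q x x2 = s Q x' x2) /\
        (side Rc < side Q / 2 ^+ m2 ->
           forall x1, cubeset Q x1 -> forall y y', cubeset Rc y -> cubeset Rc y' ->
             s Q x1 y = s Q x1 y')].

Definition shift_of_complexity (d : nat) (D : set (cube d)) (rho : nat)
    (s : cube d -> Rsp d -> Rsp d -> R) : Prop :=
  exists m1 m2 : nat, maxn 1 (maxn m1 m2) = rho /\ dyadic_shift D m1 m2 s.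

Definition shift_form_vec (d n : nat) (D : set (cube d))
    (s : cube d -> Rsp d -> Rsp d -> R) (f1 f2 : Rsp d -> 'rV[R]_n) : R :=
  \sum_(j < n) shift_form s D (fun x => f1 x ord0 j) (fun x => f2 x ord0 j).

End Euclid.

(* Main.v *)
Require Import Defs.
From HB Require Import structures.
From mathcomp Require Import all_boot all_order all_algebra.
From mathcomp Require Import all_classical all_reals all_analysis.
From mathcomp Require Import measurable_realfun ring lra zify.
Import Order.TTheory GRing.Theory Num.Theory.
Import numFieldNormedType.Exports.
Local Open Scope classical_set_scope.
Local Open Scope ring_scope.

(** For a cube [P], Gaussian elimination with almost maximal pivots in [K = <f1>_P]
    gives dual frames [w_i, v_i] with [k = \sum_i (w_i . k) v_i] and [|w_i . k| <= 2] on
    [K], and [v_i] in [3^n K].  With the scalar functions [c_i = w_i . f1] and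
    [g_i = v_i . f2] the vector form becomes [\sum_i S(c_i, g_i)], and the product of the
    means of [|c_i|] and [|g_i|] over [P] is at most [2 * 3^n * <f1>_P <f2>_P].  So it
    suffices to run a scalar stopping time argument on these [2n] functions: below [P]
    one stops at the maximal cubes where some mean exceeds [8n + 1] times its value on
    [P]; they fill at most half of [P], and iterating from a cube containing both
    supports gives the sparse family.

    The cubes of the shift are distributed among the smallest selected cubes containing
    them.  Within one block everything is finite: the shift is constant on the cells of a
    fine dyadic grid, so no differentiation theorem is needed.  Replacing the functions
    by their means over the maximal grid cubes that contain no cube of the block leaves a
    bounded form, controlled by [L^2]; the mean-zero remainders are only seen by [m1]
    (resp. [m2]) generations of cubes, whence the linear dependence on the complexity. *)

(** * Calderon-Zygmund decomposition on a finite grid *)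

Section Grid.
Variables (R : rcfType) (I : finType) (J : eqType) (N B : nat).
(** The elements of [I] model the cells of a dyadic grid with [N] generations, and [E k r r'] says
    that two cells lie in the same cube of generation [k]. A member [j] of [T] models the cube of
    generation [l j] around the cell [c j]; [B] models the number [2 ^ d] of children of a cube. *)
Variables (E : nat -> rel I) (T : seq J) (l : J -> nat) (c : J -> I).
Hypothesis E_equiv : forall k, equivalence_rel (E k).
Hypothesis E_mono : forall k k' r r', (k <= k')%N -> E k' r r' -> E k r r'.
Hypothesis E_zero : forall r r', E 0 r r'.
Hypothesis E_card : forall k r, (k < N)%N -> (#|E k r| <= B * #|E k.+1 r|)%N.
Hypothesis T_uniq : uniq T.
Hypothesis l_lt : forall j, j \in T -> (l j < N)%N.
Hypothesis T_inj : forall j j', j \in T -> j' \in T -> l j = l j' ->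
  E (l j) (c j) (c j') -> j = j'.

Let E_refl k : reflexive (E k).
Proof. by move=> r; have [] := E_equiv k r r r. Qed.

Let E_sym k : symmetric (E k).
Proof.
move=> x y; have /equivalence_relP[hr h] := E_equiv k.
by apply/idP/idP => /h <-; exact: hr.
Qed.

Let E_trans k : transitive (E k).
Proof. by have /equivalence_relP[_ h] := E_equiv k => y x z /h ->. Qed.

(** Open classes are those that contain a cube of [T] or are one; the stopping condition controls
    the means exactly on them. *)
Definition grid_open (k : nat) (r : I) : bool :=
  has (fun j => (k <= l j)%N && E k (c j) r) T.

Lemma grid_open_E k r r' : E k r r' -> grid_open k r = grid_open k r'.
Proof.
move=> rr'; apply: eq_has => j; congr andb.
by apply/idP/idP => /E_trans; apply; rewrite // E_sym.
Qed.

Lemma grid_closed_ex r : exists k, ~~ grid_open k r.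
Proof.
exists N; apply/hasPn => j jT; rewrite negb_and -ltnNge l_lt//.
Qed.

(* The generation of the maximal class around [r] that contains no cube of [T]. *)
Definition grid_stop (r : I) : nat := ex_minn (grid_closed_ex r).

Lemma grid_stop_closed r : ~~ grid_open (grid_stop r) r.
Proof. by rewrite /grid_stop; case: ex_minnP. Qed.

Lemma grid_stop_min r k : ~~ grid_open k r -> (grid_stop r <= k)%N.
Proof. by rewrite /grid_stop; case: ex_minnP => m _ h /h. Qed.

Lemma grid_stop_leN r : (grid_stop r <= N)%N.
Proof.
apply: grid_stop_min; apply/hasPn => j jT; rewrite negb_and -ltnNge l_lt//.
Qed.

(** Openness depends only on the class, and by [E_mono] the two cells share all coarser classes as
    well, so neither can stop earlier than the other. This makes [grid_sim] an equivalence
    relation. *)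
Lemma grid_stop_E r r' : E (grid_stop r) r r' -> grid_stop r' = grid_stop r.
Proof.
move=> rr'; apply/eqP; rewrite eqn_leq; apply/andP; split.
  by apply: grid_stop_min; rewrite -(grid_open_E _ _ _ rr') grid_stop_closed.
rewrite leqNgt; apply/negP => lt.
have := grid_stop_closed r'; rewrite -(grid_open_E _ r r'); last first.
  exact: E_mono (ltnW lt) rr'.
by move/grid_stop_min; rewrite leqNgt lt.
Qed.

Definition grid_sim : rel I := fun r r' => E (grid_stop r) r r'.

Lemma grid_sim_sym : symmetric grid_sim.
Proof.
move=> r r'; apply/idP/idP => h; move: (h);
  by rewrite /grid_sim (grid_stop_E _ _ h) E_sym.
Qed.

Lemma grid_sim_card r r' : grid_sim r r' -> #|grid_sim r| = #|grid_sim r'|.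
Proof.
move=> h; apply: eq_card => x; rewrite -!topredE/= /grid_sim (grid_stop_E _ _ h).
by apply/idP/idP; apply: E_trans; rewrite // E_sym.
Qed.

Lemma grid_sim_card_gt0 r : (0 < #|grid_sim r|)%N.
Proof. by apply/card_gt0P; exists r; exact: E_refl. Qed.

Definition grid_mean (a : I -> R) (r : I) : R :=
  (\sum_(r' | grid_sim r r') a r') / #|grid_sim r|%:R.

(** Averaging over the classes of [grid_sim] is self-adjoint: exchanging the two sums moves the mean
    onto [w], which is constant on these classes. *)
Lemma grid_mean_adj (w a : I -> R) :
    (forall r r', grid_sim r r' -> w r = w r') ->
  \sum_r w r * grid_mean a r = \sum_r w r * a r.
Proof.
move=> hw; rewrite /grid_mean.
transitivity (\sum_r \sum_(r' | grid_sim r r') w r' * a r' / #|grid_sim r'|%:R).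
  apply: eq_bigr => r _; rewrite mulrA mulr_sumr mulr_suml; apply: eq_bigr => r' h.
  by rewrite (hw _ _ h) (grid_sim_card _ _ h).
rewrite (exchange_big_dep predT)//=; apply: eq_bigr => r' _.
rewrite (eq_bigl (grid_sim r')); last by move=> r; rewrite grid_sim_sym.
rewrite sumr_const -[LHS]mulr_natr mulfVK//.
by rewrite pnatr_eq0 -lt0n grid_sim_card_gt0.
Qed.

Lemma grid_mean_abs (a : I -> R) r :
  `|grid_mean a r| <= grid_mean (fun r => `|a r|) r.
Proof.
rewrite /grid_mean normrM [X in _ * X]ger0_norm ?invr_ge0 ?ler0n//.
by rewrite ler_wpM2r ?invr_ge0 ?ler0n// ler_norm_sum.
Qed.

Lemma grid_mean_l1 (a : I -> R) : \sum_r `|grid_mean a r| <= \sum_r `|a r|.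
Proof.
apply: (@le_trans _ _ (\sum_r 1 * grid_mean (fun r => `|a r|) r)).
  by apply: ler_sum => r _; rewrite mul1r grid_mean_abs.
by rewrite grid_mean_adj//; under eq_bigr do rewrite mul1r.
Qed.

Definition grid_form (s : J -> I -> I -> R) (u v : I -> R) : R :=
  \sum_(j <- T) \sum_(r | E (l j) (c j) r) \sum_(r' | E (l j) (c j) r')
     s j r r' * u r * v r'.

Lemma grid_stop_gt j r : j \in T -> E (l j) (c j) r -> (l j < grid_stop r)%N.
Proof.
move=> jT h; rewrite ltnNge; apply/negP => le.
have /hasPn/(_ j jT) := grid_stop_closed r.
by rewrite le (E_mono _ _ _ _ le h).
Qed.

(** A cube of [T] around [r] has generation below [grid_stop r], so only the last [m] generations
    before it qualify, and by [T_inj] each of them carries at most one such cube. This count is the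
    source of the linear dependence on the complexity. *)
Lemma grid_count (m : nat) r :
  (\sum_(j <- T) ((E (l j) (c j) r) && (grid_stop r <= l j + m)) <= m)%N.
Proof.
pose p j := E (l j) (c j) r && (grid_stop r <= l j + m)%N; 
have -> : (\sum_(j <- T) nat_of_bool (p j) = size (map l ([seq j <- T | p j])))%N.
  by rewrite size_map size_filter -sum1_count [RHS]big_mkcond.
rewrite -[X in (_ <= X)%N](size_iota (grid_stop r - m) m); apply: uniq_leq_size.
  rewrite map_inj_in_uniq ?filter_uniq// => j j'.
  rewrite !mem_filter => /andP[/andP[h1 _] jT] /andP[/andP[h2 _] jT'] e.
  apply: T_inj => //; apply: E_trans h1 _; by rewrite E_sym e.
move=> k /mapP[j]; rewrite mem_filter => /andP[/andP[h1 h2] jT] ->{k}.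
by have := grid_stop_gt _ _ jT h1; rewrite mem_iota; lia.
Qed.

Section Form.
Variables (s : J -> I -> I -> R) (m : nat).
Hypothesis s_bound : forall j r r', j \in T -> E (l j) (c j) r -> E (l j) (c j) r' ->
  `|s j r r'| <= #|E (l j) (c j)|%:R^-1.
Hypothesis s_cst : forall j r r1 r' k, j \in T -> E (l j) (c j) r ->
  E (l j) (c j) r1 -> E (l j) (c j) r' -> (l j + m < k)%N -> (k <= N)%N -> E k r r1 ->
  s j r r' = s j r1 r'.

(* The mean-zero part of [a] only sees the [m] generations above the stopping one. *)
Lemma grid_cancel j r' (a : I -> R) : j \in T -> E (l j) (c j) r' ->
  \sum_(r | E (l j) (c j) r) s j r r' * (a r - grid_mean a r) =
  \sum_(r | E (l j) (c j) r && (grid_stop r <= l j + m)%N)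
    s j r r' * (a r - grid_mean a r).
Proof.
move=> jT hr'; rewrite (bigID (fun r => (grid_stop r <= l j + m)%N))/= -[RHS]addr0.
congr (_ + _).
(* [w] keeps the kernel on the cells that stop beyond generation [l j + m]. There the kernel is
   constant on the whole stopping class, so [w] is constant on classes and is orthogonal to the
   mean-zero part. *)
pose w r := if E (l j) (c j) r && ~~ (grid_stop r <= l j + m)%N then s j r r' else 0.
have hw r r1 : grid_sim r r1 -> w r = w r1.
  move=> h; rewrite /w (grid_stop_E _ _ h).
  case: (leqP (grid_stop r) _) => [|lt]; rewrite ?andbF// !andbT.
  have h1 : E (l j) r r1.
    by apply: E_mono h; apply: leq_trans (ltnW lt); rewrite leq_addr.
  have -> : E (l j) (c j) r1 = E (l j) (c j) r.
    by apply/idP/idP => /E_trans; apply; rewrite // E_sym.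
  case: ifP => // hr; apply: (@s_cst _ _ _ _ (grid_stop r)) => //.
  - exact: E_trans h1.
  - exact: grid_stop_leN.
have e : \sum_r w r * (a r - grid_mean a r) = 0.
  by under eq_bigr do rewrite mulrBr; rewrite sumrB (grid_mean_adj w a hw) subrr.
rewrite -[RHS]e [LHS]big_mkcond; apply: eq_bigr => r _; rewrite /w.
by case: ifP => // _; rewrite mul0r.
Qed.

(** For each cube, the size of the kernel and the mean of [|p|] combine to a factor [X]; after
    exchanging sums, [grid_count] charges each cell at most [m] times. The factor [2] pays for
    [|a| + |grid_mean a|]. *)
Lemma grid_form_cancel (a p : I -> R) (X : R) : 0 <= X ->
  (forall j, j \in T ->
     \sum_(r | E (l j) (c j) r) `|p r| <= X * #|E (l j) (c j)|%:R) ->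
  `|grid_form s (fun r => a r - grid_mean a r) p| <=
    X * (m%:R * (2 * \sum_r `|a r|)).
Proof.
move=> X0 hp; apply: le_trans (ler_norm_sum _ _ _) _.
set z := fun r => a r - grid_mean a r.
pose q j r := E (l j) (c j) r && (grid_stop r <= l j + m)%N.
apply: (@le_trans _ _ (\sum_(j <- T) X * \sum_r (q j r)%:R * `|z r|)).
  rewrite big_seq [leRHS]big_seq; apply: ler_sum => j jT.
  rewrite exchange_big/=.
  have c0 : 0 < #|E (l j) (c j)|%:R :> R.
    by rewrite ltr0n; apply/card_gt0P; exists (c j); exact: E_refl.
  apply: (@le_trans _ _ (\sum_(r' | E (l j) (c j) r')
      `|p r'| * (#|E (l j) (c j)|%:R^-1 * \sum_r (q j r)%:R * `|z r|))).
    apply: le_trans (ler_norm_sum _ _ _) _; apply: ler_sum => r' hr'.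
    rewrite -mulr_suml normrM mulrC ler_wpM2l// grid_cancel//.
    apply: le_trans (ler_norm_sum _ _ _) _.
    rewrite mulr_sumr big_mkcond/=; apply: ler_sum => r _; rewrite -/(q j r).
    case: ifP => [/andP[hr _]|_]; last by rewrite mul0r mulr0.
    by rewrite mul1r normrM ler_wpM2r// s_bound.
  rewrite -mulr_suml mulrA ler_wpM2r//; last by rewrite ler_pdivrMr// hp.
  by apply: sumr_ge0 => r _; rewrite mulr_ge0.
rewrite -mulr_sumr ler_wpM2l// exchange_big/=.
apply: (@le_trans _ _ (\sum_r m%:R * `|z r|)).
  apply: ler_sum => r _; rewrite -mulr_suml ler_wpM2r// -natr_sum ler_nat.
  exact: grid_count.
rewrite -mulr_sumr ler_wpM2l// mulr_natl mulr2n.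
apply: (@le_trans _ _ (\sum_r (`|a r| + `|grid_mean a r|))).
  by apply: ler_sum => r _; exact: ler_normB.
by rewrite big_split/= lerD2l grid_mean_l1.
Qed.

End Form.

Section MeanBounds.
Variables (a : I -> R) (F V : R).
Hypothesis F0 : 0 <= F.
Hypothesis aF : forall k r, grid_open k r ->
  \sum_(r' | E k r r') `|a r'| <= F * #|E k r|%:R.
Hypothesis aV : \sum_r `|a r| <= F * V.

(** The parent of the stopping class is open by minimality, so the mean bound holds on it, and it
    has at most [B] times as many cells. As [T] is nonempty, the root is open and the parent
    exists. *)
Lemma grid_mean_le r : T != [::] -> `|grid_mean a r| <= B%:R * F.
Proof.
move=> T0; apply: le_trans (grid_mean_abs _ _) _.
have [k Ek] : exists k, grid_stop r = k.+1.
  case: (grid_stop r) (grid_stop_closed r) => [|k] h; last by exists k.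
  have /negP[] := h; have [j jT] : exists j, j \in T.
    by case: T T0 => [|j T0] // _; exists j; exact: mem_head.
  by apply/hasP; exists j => //; rewrite leq0n E_zero.
rewrite /grid_mean /grid_sim Ek.
have lt : (k < N)%N by rewrite -Ek grid_stop_leN.
have o : grid_open k r.
  by apply: contraT => /grid_stop_min; rewrite Ek ltnn.
rewrite ler_pdivrMr; last first.
  by rewrite ltr0n; apply/card_gt0P; exists r; exact: E_refl.
apply: (@le_trans _ _ (\sum_(r' | E k r r') `|a r'|)).
  rewrite big_mkcond [leRHS]big_mkcond/=; apply: ler_sum => r' _.
  case: ifP => [h|_]; last by case: ifP.
  by rewrite (E_mono _ _ _ _ _ h).
apply: le_trans (aF _ _ o) _.
rewrite -mulrA mulrCA ler_wpM2l// -natrM ler_nat; exact: E_card.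
Qed.

Lemma grid_mean_sq : T != [::] -> \sum_r grid_mean a r ^+ 2 <= B%:R * F ^+ 2 * V.
Proof.
move=> T0; apply: (@le_trans _ _ (\sum_r B%:R * F * `|grid_mean a r|)).
  apply: ler_sum => r _; rewrite -(real_normK (num_real _)) expr2.
  by rewrite ler_wpM2r// grid_mean_le.
rewrite -mulr_sumr expr2 !mulrA -[leRHS]mulrA ler_wpM2l ?mulr_ge0 ?ler0n//.
exact: le_trans (grid_mean_l1 _) aV.
Qed.

End MeanBounds.

Lemma grid_open_class k r j : j \in T -> (k <= l j)%N -> E k (c j) r -> grid_open k r.
Proof. by move=> jT h1 h2; apply/hasP; exists j => //; rewrite h1. Qed.

Lemma grid_form_flip (s : J -> I -> I -> R) u v :
  grid_form s u v = grid_form (fun j r r' => s j r' r) v u.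
Proof.
apply: eq_bigr => j _; rewrite exchange_big/=; apply: eq_bigr => r _.
by apply: eq_bigr => r' _; rewrite mulrAC.
Qed.

Lemma grid_formDl s u u' v :
  grid_form s (fun r => u r + u' r) v = grid_form s u v + grid_form s u' v.
Proof.
rewrite /grid_form -big_split/=; apply: eq_bigr => j _.
rewrite -big_split/=; apply: eq_bigr => r _.
by rewrite -big_split/=; apply: eq_bigr => r' _; rewrite mulrDr mulrDl.
Qed.

(* Calderon-Zygmund decomposition at the stopping classes: the form of the means is
   bounded through [L^2], and the rest only sees [m1] (resp. [m2]) generations. *)
Lemma grid_form_bound (s : J -> I -> I -> R) (m1 m2 : nat) (a b : I -> R) (F G V : R) :
  (forall j r r', j \in T -> E (l j) (c j) r -> E (l j) (c j) r' ->
     `|s j r r'| <= #|E (l j) (c j)|%:R^-1) ->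
  (forall j r r1 r' k, j \in T -> E (l j) (c j) r ->
     E (l j) (c j) r1 -> E (l j) (c j) r' -> (l j + m1 < k)%N -> (k <= N)%N ->
     E k r r1 -> s j r r' = s j r1 r') ->
  (forall j r r1 r' k, j \in T -> E (l j) (c j) r ->
     E (l j) (c j) r1 -> E (l j) (c j) r' -> (l j + m2 < k)%N -> (k <= N)%N ->
     E k r r1 -> s j r' r = s j r' r1) ->
  (forall u v, `|grid_form s u v| <=
     Num.sqrt (\sum_r u r ^+ 2) * Num.sqrt (\sum_r v r ^+ 2)) ->
  0 <= F -> 0 <= G -> 0 <= V ->
  (forall k r, grid_open k r -> \sum_(r' | E k r r') `|a r'| <= F * #|E k r|%:R) ->
  (forall k r, grid_open k r -> \sum_(r' | E k r r') `|b r'| <= G * #|E k r|%:R) ->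
  \sum_r `|a r| <= F * V -> \sum_r `|b r| <= G * V ->
  `|grid_form s a b| <= (B + 2 * m1 + 2 * B * m2)%:R * (F * G * V).
Proof.
move=> s_bound s_cst1 s_cst2 s_L2 F0 G0 V0 aF bG aV bV.
have [T0|T0] := eqVneq T [::].
  by rewrite /grid_form T0 big_nil normr0 mulr_ge0 ?ler0n// !mulr_ge0.
(* With [M] for the mean, [s(a, b) = s(M a, M b) + s(a - M a, b) + s(M a, b - M b)]. *)
have -> : grid_form s a b = grid_form s (grid_mean a) (grid_mean b) +
    grid_form s (fun r => a r - grid_mean a r) b +
    grid_form s (grid_mean a) (fun r => b r - grid_mean b r).
  rewrite -addrA addrCA [X in _ = _ + X]addrC.
  have -> : grid_form s (grid_mean a) (fun r => b r - grid_mean b r) +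
      grid_form s (grid_mean a) (grid_mean b) = grid_form s (grid_mean a) b.
    rewrite !(grid_form_flip s) -grid_formDl; apply: eq_bigr => j _.
    by apply: eq_bigr => r _; apply: eq_bigr => r' _; rewrite subrK.
  rewrite -grid_formDl; apply: eq_bigr => j _.
  by apply: eq_bigr => r _; apply: eq_bigr => r' _; rewrite subrK.
have openC j : j \in T -> grid_open (l j) (c j).
  by move=> jT; apply: grid_open_class jT (leqnn _) (E_refl _ _).
rewrite (natrD _ (B + 2 * m1)) (natrD _ B) !mulrDl.
apply: le_trans (ler_normD _ _) _; apply: lerD.
  apply: le_trans (ler_normD _ _) _; apply: lerD.
    apply: le_trans (s_L2 _ _) _.
    have -> : B%:R * (F * G * V) =
        Num.sqrt (B%:R * F ^+ 2 * V) * Num.sqrt (B%:R * G ^+ 2 * V).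
      rewrite -sqrtrM ?mulr_ge0 ?ler0n ?exprn_ge0//.
      have -> : B%:R * F ^+ 2 * V * (B%:R * G ^+ 2 * V) = (B%:R * (F * G * V)) ^+ 2.
        by ring.
      by rewrite sqrtr_sqr ger0_norm// mulr_ge0 ?ler0n// !mulr_ge0.
    by apply: ler_pM; rewrite ?sqrtr_ge0// ler_wsqrtr// grid_mean_sq.
  apply: le_trans (@grid_form_cancel s m1 s_bound s_cst1 a b G G0 _) _.
    by move=> j jT; apply: bG; exact: openC.
  have -> : (2 * m1)%:R * (F * G * V) = G * (m1%:R * (2 * (F * V))).
    by rewrite natrM; ring.
  by rewrite !ler_wpM2l.
rewrite grid_form_flip.
(* Here the other factor is [grid_mean a], bounded pointwise by [B * F]; hence the extra [B] in
   front of [m2]. *)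
apply: le_trans (@grid_form_cancel (fun j r r' => s j r' r) m2 _ _ b (grid_mean a)
  (B%:R * F) _ _) _.
- by move=> j r r' jT h1 h2; exact: s_bound.
- by move=> j r r1 r' k jT h h1 h2 lk kN Ek; apply: (s_cst2 _ _ _ _ k).
- by rewrite mulr_ge0 ?ler0n.
- move=> j jT; apply: le_trans (ler_sum _ (fun r _ => grid_mean_le _ _ F0 aF r T0)) _.
  by rewrite sumr_const mulr_natr.
have -> : (2 * B * m2)%:R * (F * G * V) = B%:R * F * (m2%:R * (2 * (G * V))).
  by rewrite !natrM; ring.
by rewrite !ler_wpM2l// mulr_ge0 ?ler0n.
Qed.
End Grid.

(** * Dual frames of a convex body *)

Section Frame.
Variables (R : realType) (n : nat) (K : set 'rV[R]_n) (M : R).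
Hypothesis K_bound : forall k j, K k -> `|k ord0 j| <= M.
Hypothesis K_zero : K 0.
Hypothesis K_conv : forall k h a b, K k -> K h -> `|a| + `|b| <= 1 ->
  K (a *: k + b *: h).

Let K_scale k a : K k -> `|a| <= 1 -> K (a *: k).
Proof.
move=> Kk a1; rewrite -[_ *: _]addr0 -(scale0r (0 : 'rV[R]_n)).
by apply: K_conv => //; rewrite normr0 addr0.
Qed.

(** A point within a factor [2] of the supremum serves as pivot, since the supremum may not be
    attained on [K]. *)
Let half_max (g : 'rV[R]_n -> R) (B : R) : (forall k, K k -> `|g k| <= B) ->
  (forall k, K k -> g k = 0) \/
  exists k0, [/\ K k0, g k0 != 0 & forall k, K k -> `|g k| <= 2 * `|g k0|].
Proof.
move=> gB; have [h|] := pselect (forall k, K k -> g k = 0).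
  by left.
move=> /existsNP[k1 /not_implyP[Kk1 /eqP gk1]]; right.
pose S : set R := (fun k => `|g k|) @` K.
have S0 : S `|g k1| by exists k1.
have hS : has_sup S.
  by split; [by exists (`|g k1|)|exists B => _ [k Kk <-]; exact: gB].
have s0 : 0 < sup S.
  by apply: (@lt_le_trans _ _ `|g k1|); rewrite ?normr_gt0//; exact: sup_upper_bound.
have [] := @sup_adherent _ S (sup S / 2) _ hS; first by rewrite divr_gt0.
move=> _ [k0 Kk0 <-] lt; exists k0; split=> //.
  by rewrite -normr_gt0; apply: lt_trans lt; lra.
move=> k Kk; apply: (@le_trans _ _ (sup S)); last by lra.
by apply: sup_upper_bound => //; exists k.
Qed.

(** [P] sends [k] to its residue after [m] eliminations. Each elimination subtracts at most twice
    the residue of the pivot, so the residues grow at most by a factor [1 + 2 = 3] relative to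
    [K]. *)
Let frame_step (m : nat) : (m <= n)%N ->
  exists (P : 'M[R]_n) (w : nat -> 'cV[R]_n) (v : nat -> 'rV[R]_n),
    [/\ forall k, K k -> K ((3 ^+ m)^-1 *: (k *m P)),
        forall k (j : 'I_n), K k -> (j < m)%N -> (k *m P) ord0 j = 0,
        forall k, K k -> k = k *m P + \sum_(i < m) (k *m w i) ord0 ord0 *: v i,
        forall k i, K k -> (i < m)%N -> `|(k *m w i) ord0 ord0| <= 2 &
        forall i, (i < m)%N -> K ((3 ^+ n)^-1 *: v i)].
Proof.
elim: m => [_|m IH mn].
  exists 1%:M, (fun=> 0), (fun=> 0); split=> // k.
  - by rewrite mulmx1 invr1 scale1r.
  - by rewrite mulmx1 big_ord0 addr0.
have [P [w [v [KP P0 kE w2 Kv]]]] := IH (ltnW mn).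
pose j0 := Ordinal mn; pose g (k : 'rV[R]_n) := (k *m P) ord0 j0.
have p3 q : 0 < (3 ^+ q : R) by rewrite exprn_gt0.
have [|g0|[k0 [Kk0 gk0 gmax]]] := half_max g (3 ^+ m * M).
- move=> k Kk; have := K_bound _ j0 (KP _ Kk); rewrite mxE normrM -/(g k).
  by rewrite gtr0_norm ?invr_gt0// ler_pdivrMl.
(* The coordinate already vanishes on all residues; a zero pair fills its slot. *)
- exists P, (fun i => if i == m then 0 else w i), (fun i => if i == m then 0 else v i).
  split.
  + move=> k Kk; rewrite exprS invfM -scalerA; apply: K_scale; first exact: KP.
    by rewrite ger0_norm; lra.
  + move=> k j Kk; rewrite ltnS leq_eqVlt => /predU1P[jm|]; last exact: P0.
    by have -> : j = j0 by [apply: val_inj]; exact: g0.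
  + move=> k Kk; rewrite [LHS]kE// big_ord_recr/= eqxx scaler0 addr0; congr (_ + _).
    by apply: eq_bigr => i _; rewrite ltn_eqF.
  + move=> k i Kk; rewrite ltnS leq_eqVlt => /predU1P[->|im].
      by rewrite eqxx mulmx0 mxE normr0.
    by rewrite ltn_eqF// w2.
  + move=> i; rewrite ltnS leq_eqVlt => /predU1P[->|im].
      by rewrite eqxx scaler0.
    by rewrite ltn_eqF//; exact: Kv.
(* [wm] reads the coordinate of the residue relative to that of the pivot, and [vm] is the residue
   of the pivot. *)
pose wm : 'cV[R]_n := (g k0)^-1 *: col j0 P.
pose vm := k0 *m P.
have wmE (k : 'rV[R]_n) : (k *m wm) ord0 ord0 = g k / g k0.
  rewrite -scalemxAr mxE mulrC; congr (_ / _); rewrite /g !mxE.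
  by apply: eq_bigr => i _; rewrite !mxE.
exists (P - wm *m vm), (fun i => if i == m then wm else w i),
  (fun i => if i == m then vm else v i).
have kP' k : k *m (P - wm *m vm) = k *m P - (g k / g k0) *: vm.
  rewrite mulmxBr mulmxA; congr (_ - _).
  by rewrite [k *m wm]mx11_scalar wmE mul_scalar_mx.
have t2 k : K k -> `|g k / g k0| <= 2.
  by move=> Kk; rewrite normrM normfV ler_pdivrMr ?normr_gt0// gmax.
split.
- move=> k Kk; rewrite kP'.
  (* The two weights are [1 / 3] and at most [2 / 3] in absolute value, as [K_conv] requires. *)
  have -> : (3 ^+ m.+1)^-1 *: (k *m P - (g k / g k0) *: vm) =
      3^-1 *: ((3 ^+ m)^-1 *: (k *m P)) +
      (- (3^-1 * (g k / g k0))) *: ((3 ^+ m)^-1 *: vm).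
    rewrite scaleNr !scalerA exprS invfM scalerBr scalerA; congr (_ - _ *: _).
    by rewrite mulrAC.
  apply: K_conv; [exact: KP|exact: KP|].
  by rewrite normrN normrM ger0_norm ?invr_ge0//; have := t2 _ Kk; lra.
- move=> k j Kk; rewrite kP' ltnS leq_eqVlt => /predU1P[jm|jm].
    have -> : j = j0 by apply: val_inj.
    have e (A B : 'rV[R]_n) c : (A - c *: B) ord0 j0 = A ord0 j0 - c * B ord0 j0.
      by rewrite !mxE.
    by rewrite e -/(g k) -/(g k0) divfK// subrr.
  by rewrite [LHS]mxE P0// add0r mxE [X in - X]mxE P0// mulr0 oppr0.
- move=> k Kk; rewrite big_ord_recr/= eqxx kP' wmE.
  rewrite [LHS]kE// -addrA [X in _ = _ + X]addrCA addNr addr0; congr (_ + _).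
  by apply: eq_bigr => i _; rewrite ltn_eqF.
- move=> k i Kk; rewrite ltnS leq_eqVlt => /predU1P[->|im].
    by rewrite eqxx wmE t2.
  by rewrite ltn_eqF// w2.
- move=> i; rewrite ltnS leq_eqVlt => /predU1P[->|im]; last by rewrite ltn_eqF//; exact: Kv.
  rewrite eqxx.
  have -> : (3 ^+ n)^-1 *: vm = (3 ^+ (n - m))^-1 *: ((3 ^+ m)^-1 *: vm).
    by rewrite scalerA -invfM -exprD subnK// ltnW.
  apply: K_scale; first exact: KP.
  by rewrite gtr0_norm ?invr_gt0// invf_le1// exprn_ege1//; lra.
Qed.

(* A substitute for John's ellipsoid (or Auerbach's lemma) that needs neither
   compactness nor full dimension of [K]: Gaussian elimination with pivots taken in [K],
   each of them half maximal for its coordinate. *)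
Lemma almost_auerbach : exists W V : 'M[R]_n,
  [/\ forall k, K k -> k *m W *m V = k,
      forall k i, K k -> `|(k *m W) ord0 i| <= 2 &
      forall i, K ((3 ^+ n)^-1 *: row i V)].
Proof.
have [P [w [v [_ P0 kE w2 Kv]]]] := frame_step n (leqnn n).
exists (\matrix_(i, j) w j i ord0), (\matrix_i v i); split.
- move=> k Kk; rewrite [RHS]kE//.
  have -> : k *m P = 0 by apply/rowP => j; rewrite P0// mxE.
  rewrite add0r mulmx_sum_row; apply: eq_bigr => i _; rewrite rowK; congr (_ *: _).
  by rewrite !mxE; apply: eq_bigr => j _; rewrite !mxE.
- move=> k i Kk; have := w2 _ _ Kk (ltn_ord i); congr (`|_| <= _).
  by rewrite !mxE; apply: eq_bigr => j _; rewrite !mxE.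
- by move=> i; rewrite rowK; exact: Kv.
Qed.
End Frame.

(** * Integrals *)

Section RintegralMisc.
Context d (T : measurableType d) (R : realType).
Variable mu : {measure set T -> \bar R}.

Lemma Rintegral_sum (I : Type) (r : seq I) (P : pred I) (h : I -> T -> R) (D : set T) :
  measurable D -> (forall i, mu.-integrable D (EFin \o h i)) ->
  Rintegral mu D (fun x => \sum_(i <- r | P i) h i x) =
  \sum_(i <- r | P i) Rintegral mu D (h i).
Proof.
move=> mD hi; rewrite /Rintegral.
under eq_integral do rewrite -sumEFin.
rewrite (@integral_sum _ _ _ mu D mD _ (fun i => EFin \o h i))//.
by apply/esym; apply: sum_fine => i _; apply: integrable_fin_num (hi i).
Qed.

Lemma restrict_indic (A : set T) (h : T -> R) : h \_ A = fun x => h x * (x \in A)%:R.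
Proof.
by apply/funext => x; rewrite patchE; case: ifP; rewrite ?mulr1 ?mulr0.
Qed.

Lemma integrable_EFin_restrict (A : set T) (h : T -> R) : measurable A ->
  mu.-integrable setT (EFin \o h) -> mu.-integrable setT (EFin \o (h \_ A)).
Proof.
move=> mA hi; rewrite -restrict_EFin; apply: (integrable_mkcond (EFin \o h) mA).1.
exact: (integrableS measurableT mA (@subsetT _ _) hi).
Qed.

(** The identity of indicators says at once that the selected pieces are disjoint and that they fill
    [A]; the claim is then linearity. *)
Lemma Rintegral_partition (I : finType) (P : pred I) (A : set T) (B : I -> set T)
    (h : T -> R) :
  measurable A -> (forall r, measurable (B r)) -> mu.-integrable setT (EFin \o h) ->
  (forall x, (x \in A)%:R = \sum_(r | P r) (x \in B r)%:R :> R) ->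
  Rintegral mu A h = \sum_(r | P r) Rintegral mu (B r) h.
Proof.
move=> mA mB hi AB; rewrite Rintegral_mkcond restrict_indic.
under eq_Rintegral do rewrite AB mulr_sumr.
rewrite Rintegral_sum//; last first.
  by move=> r; rewrite -restrict_indic; exact: integrable_EFin_restrict.
by apply: eq_bigr => r _; rewrite [RHS]Rintegral_mkcond restrict_indic.
Qed.
End RintegralMisc.

(** * Fubini for products of functions of separate variables *)

Section ProductIntegral.
Context d1 d2 (T1 : measurableType d1) (T2 : measurableType d2) (R : realType).
Variables (m1 : {sigma_finite_measure set T1 -> \bar R})
          (m2 : {sigma_finite_measure set T2 -> \bar R}).
Variables (h1 : T1 -> R) (h2 : T2 -> R).
Hypothesis h1i : m1.-integrable setT (EFin \o h1).
Hypothesis h2i : m2.-integrable setT (EFin \o h2).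

Lemma integrable_prodM :
  (prodSF m1 m2).-integrable setT (fun z => (h1 z.1 * h2 z.2)%:E).
Proof.
have mh1 : measurable_fun setT h1 by apply/measurable_EFinP; exact: measurable_int h1i.
have mh2 : measurable_fun setT h2 by apply/measurable_EFinP; exact: measurable_int h2i.
apply/(@integrable12ltyP _ _ _ _ _ m1 m2) => /=.
  apply/measurable_EFinP; apply: measurable_funM.
    exact: (measurableT_comp mh1 measurable_fst).
  exact: (measurableT_comp mh2 measurable_snd).
have [_ i1] := integrableP _ _ _ h1i; have [_ i2] := integrableP _ _ _ h2i.
have e x : (\int[m2]_y `|(h1 x * h2 y)%:E| = `|h1 x|%:E * \int[m2]_y `|(h2 y)%:E|)%E.
  rewrite -ge0_integralZl//; last first.
    by apply: measurableT_comp => //; exact/measurable_EFinP.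
  by apply: eq_integral => y _; rewrite /= normrM EFinM.
under eq_integral do rewrite e.
rewrite ge0_integralZr//.
- apply: lte_mul_pinfty => //; first exact: integral_ge0.
  rewrite ge0_fin_numE//; exact: integral_ge0.
- by do 2 apply: measurableT_comp => //.
- exact: integral_ge0.
Qed.

Lemma Rintegral_prodM :
  Rintegral (prodSF m1 m2) setT (fun z => h1 z.1 * h2 z.2) =
  Rintegral m1 setT h1 * Rintegral m2 setT h2.
Proof.
rewrite /Rintegral.
have -> : (\int[prodSF m1 m2]_z (h1 z.1 * h2 z.2)%:E =
    \int[m1]_x \int[m2]_y (h1 x * h2 y)%:E)%E.
  by rewrite -(integral12_prod_meas1 integrable_prodM).
have -> : (\int[m1]_x \int[m2]_y (h1 x * h2 y)%:E =
    \int[m1]_x (h1 x)%:E * \int[m2]_y (h2 y)%:E)%E.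
  rewrite -[X in (_ * X)%E]fineK; last exact: integrable_fin_num.
  rewrite -integralZr//; apply: eq_integral => x _.
  by rewrite fineK ?integrable_fin_num// -integralZl.
by rewrite fineM//; exact: integrable_fin_num.
Qed.
End ProductIntegral.

(** On [A * A] the integrand is a finite combination of products of functions of one variable,
    because the kernel is constant on each product of cells. Each term then factors by Fubini. *)
Lemma Rintegral_prod_cells d (T : measurableType d) (R : realType)
    (m : {sigma_finite_measure set T -> \bar R}) (h1 h2 : T -> R)
    (I : finType) (P : pred I) (A : set T) (B : I -> set T)
    (s : T -> T -> R) (sigma : I -> I -> R) :
  m.-integrable setT (EFin \o h1) -> m.-integrable setT (EFin \o h2) ->
  (forall r, measurable (B r)) ->
  (forall x, (x \in A)%:R = \sum_(r | P r) (x \in B r)%:R :> R) ->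
  (forall r r' x y, P r -> P r' -> B r x -> B r' y -> s x y = sigma r r') ->
  Rintegral (prodSF m m) (A `*` A) (fun z => s z.1 z.2 * h1 z.1 * h2 z.2) =
  \sum_(r | P r) \sum_(r' | P r')
     sigma r r' * Rintegral m (B r) h1 * Rintegral m (B r') h2.
Proof.
move=> h1i h2i mB AB sE.
have e (z : T * T) : ((fun z => s z.1 z.2 * h1 z.1 * h2 z.2) \_ (A `*` A)) z =
    \sum_(r | P r) \sum_(r' | P r')
      sigma r r' * (h1 \_ (B r)) z.1 * (h2 \_ (B r')) z.2.
  rewrite restrict_indic in_setX -mulnb natrM !AB mulr_suml mulr_sumr.
  apply: eq_bigr => r Pr; rewrite !mulr_sumr; apply: eq_bigr => r' Pr'.
  rewrite !restrict_indic; case: (boolP (z.1 \in B r)) => /= h; last by rewrite !(mul0r,mulr0).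
  case: (boolP (z.2 \in B r')) => /= h'; last by rewrite !(mul0r,mulr0).
  by rewrite (sE r r') ?mulr1//; exact: set_mem.
rewrite Rintegral_mkcond.
under eq_Rintegral do rewrite e.
pose g r r' := fun z : T * T => (h1 \_ (B r)) z.1 * (h2 \_ (B r')) z.2.
have gi r r' : (prodSF m m).-integrable setT (EFin \o g r r').
  by apply: integrable_prodM; exact: integrable_EFin_restrict.
have sgi r r' : (prodSF m m).-integrable setT
    (EFin \o (fun z : T * T => sigma r r' * (h1 \_ (B r)) z.1 * (h2 \_ (B r')) z.2)).
  have := integrableZl measurableT (sigma r r') (gi r r'); apply: eq_integrable => //.
  by move=> z _; rewrite /= /g -EFinM mulrA.
rewrite Rintegral_sum//; last first.
  move=> r; rewrite (_ : _ \o _ = fun z => (\sum_(r' | P r') (EFin \o (fun z : T * T =>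
      (sigma r r' * (h1 \_ (B r)) z.1 * (h2 \_ (B r')) z.2)%R)) z)%E).
    by apply: integrable_sum => // r' _; exact: sgi.
  by apply/funext => z; rewrite /= sumEFin.
apply: eq_bigr => r _; rewrite Rintegral_sum//; apply: eq_bigr => r' _.
under eq_Rintegral do rewrite -mulrA.
rewrite RintegralZl//; last exact: gi.
rewrite -mulrA; congr (_ * _).
by rewrite Rintegral_prodM ?integrable_EFin_restrict// -!Rintegral_mkcond.
Qed.

Set Implicit Arguments.
Unset Strict Implicit.
Unset Printing Implicit Defensive.

(** * Dyadic cubes *)

Section Box.
Variable R : realType.

Fixpoint pointRD (k : nat) (c : nat -> R) : RDt R k :=
  match k return RDt R k with
  | 0 => c 0%N
  | k.+1 => (c 0%N, pointRD k (fun i => c i.+1))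
  end.

Lemma coord_pointRD k c i : (i <= k)%N -> coordRD (pointRD k c) i = c i.
Proof.
elim: k c i => [|k IH] c [|i]//= ik; exact: (IH (fun i => c i.+1)).
Qed.

(** Corners are indexed by [nat], so that shifting the index splits off the first coordinate of the
    iterated product. *)
Definition boxRD (k : nat) (c : nat -> R) (s : R) : set (RDt R k) :=
  [set x | forall i, (i <= k)%N -> c i <= coordRD x i < c i + s].

Lemma boxRD0 c s : boxRD (k:=0) c s = `[c 0%N, c 0%N + s[%classic.
Proof.
apply/seteqP; split=> x; rewrite /= in_itv/=; first by move/(_ 0%N); exact.
by move=> h [|i].
Qed.

Lemma boxRDS k c s :
  boxRD (k:=k.+1) c s = `[c 0%N, c 0%N + s[%classic `*` boxRD (k:=k) (fun i => c i.+1) s.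
Proof.
apply/seteqP; split=> x /=.
  move=> h; split; first by rewrite in_itv/=; exact: (h 0%N).
  by move=> i ik; exact: (h i.+1).
by case; rewrite in_itv/= => h0 h [|i] ik; [exact: h0|exact: h].
Qed.

Lemma measurable_boxRD k c s : measurable (boxRD (k:=k) c s).
Proof.
elim: k c => [|k IH] c; first by rewrite boxRD0; exact: measurable_itv.
by rewrite boxRDS; apply: measurableX; [exact: measurable_itv|exact: IH].
Qed.

Lemma lebRD_boxRD k c s : 0 < s -> lebRD R k (boxRD c s) = (s ^+ k.+1)%:E.
Proof.
move=> s0.
have itvE (a : R) : lebesgue_measure (`[a, a + s[%classic : set R) = s%:E.
  rewrite lebesgue_measure_itv/= lte_fin ltrDl s0 -EFinD.
  by congr EFin; rewrite addrAC subrr add0r.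
elim: k c => [|k IH] c; first by rewrite boxRD0 expr1; exact: itvE.
rewrite boxRDS /=.
rewrite [LHS](@product_measure1E _ _ _ _ _ (lebR R) (lebRD R k) _ _ (measurable_itv _)
  (measurable_boxRD _ _ _)).
rewrite [X in (_ * X)%E]IH [X in (X * _)%E]itvE -EFinM.
by rewrite [in RHS]exprS.
Qed.

End Box.
Arguments boxRD {R k} c s.
Arguments pointRD {R} k c.

Section CubeMeasure.
Variables (R : realType) (d : nat).
Hypothesis d_gt0 : (0 < d)%N.
Implicit Type Q : cube R d.

Let cn Q (i : nat) : R := oapp (corner Q) 0 (insub i).

Let cubesetE Q : cubeset Q = boxRD (cn Q) (side Q).
Proof.
apply/seteqP; split=> x /= h i.
  move=> id; have id' : (i < d)%N by rewrite -(prednK d_gt0) ltnS.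
  by have := h (Ordinal id'); rewrite /cn insubT.
have id : (i <= d.-1)%N by rewrite -ltnS prednK.
by have := h i id; rewrite /cn valK.
Qed.

Lemma measurable_cubeset Q : measurable (cubeset Q).
Proof. by rewrite cubesetE; exact: measurable_boxRD. Qed.

Lemma leb_cubeset Q : 0 < side Q -> leb R d (cubeset Q) = (vol Q)%:E.
Proof. by move=> s0; rewrite cubesetE [LHS]lebRD_boxRD// prednK. Qed.

Lemma corner_point Q : {x : Rsp R d | forall i, Defs.coord x i = corner Q i}.
Proof.
exists (pointRD d.-1 (cn Q)) => i.
have id : (i <= d.-1)%N by rewrite -ltnS prednK.
by rewrite /Defs.coord coord_pointRD// /cn valK.
Qed.
End CubeMeasure.

(** * Nesting of lattice cubes *)

Section Descendants.
Variables (R : realType) (d : nat).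
Implicit Types (A B Q : cube R d).

Lemma cube_eq A B : side A = side B -> (forall i, corner A i = corner B i) -> A = B.
Proof. by case: A B => [cA sA] [cB sB] /= -> h; congr Cube; apply/funext. Qed.

Lemma descendant_refl A : descendant 0 A A.
Proof. by split=> [|i]; [rewrite divr1|exists 0%N; rewrite mul0r addr0]. Qed.

Lemma descendant0 A B : descendant 0 A B -> A = B.
Proof.
move=> [sE cE]; apply: cube_eq => [|i]; first by rewrite sE divr1.
by have [m []] := cE i; rewrite ltnS leqn0 => /eqP -> ->; rewrite mul0r addr0.
Qed.

Lemma descendant_trans k l A B Q :
  descendant k A B -> descendant l B Q -> descendant (k + l) A Q.
Proof.
move=> [sA cA] [sB cB]; split; first by rewrite sA sB exprD [2 ^+ k * _]mulrC invfM mulrA.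
move=> i; have [a [ak ->]] := cA i; have [b [bl ->]] := cB i.
exists (b * 2 ^ k + a)%N; split.
  apply: (@leq_trans (b * 2 ^ k + 2 ^ k)); first by rewrite ltn_add2l.
  by rewrite -mulSnr expnD mulnC leq_mul2l bl orbT.
rewrite natrD natrM natrX mulrDl addrA; congr (_ + _ + _).
by rewrite sA -mulrA [X in _ = _ * X]mulrC divfK// expf_neq0.
Qed.

Lemma descendant_subset k A B : 0 < side B -> descendant k A B ->
  cubeset A `<=` cubeset B.
Proof.
move=> s0 [sA cA] x xA i; have := xA i; have [m [mk ->]] := cA i.
have e : side B = 2 ^+ k * side A by rewrite sA mulrC divfK// expf_neq0.
have sA0 : 0 < side A by rewrite sA divr_gt0// exprn_gt0.
have : m.+1%:R * side A <= side B.
  by rewrite e ler_pM2r// -natrX ler_nat.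
rewrite -natr1 mulrDl mul1r => h /andP[h1 h2].
have : 0 <= m%:R * side A by rewrite mulr_ge0 ?ler0n// ltW.
lra.
Qed.

Lemma descendant_side_gt0 k A B : 0 < side B -> descendant k A B -> 0 < side A.
Proof. by move=> s0 [-> _]; rewrite divr_gt0// exprn_gt0. Qed.

(** Dividing the integer position of [A] by [2 ^ k] gives the child of [B] as quotient and the place
    of [A] inside this child as remainder. *)
Lemma descendant_split k A B : descendant k.+1 A B ->
  exists Q, descendant 1 Q B /\ descendant k A Q.
Proof.
move=> [sA cA].
have [m mP] := choice cA.
pose Q : cube R d := Cube (fun i => corner B i + (m i %/ 2 ^ k)%:R * (side B / 2 ^+ 1))
  (side B / 2 ^+ 1).
exists Q; split; split=> //.
- by move=> i; exists (m i %/ 2 ^ k)%N; split=> //; rewrite ltn_divLR ?expn_gt0// -expnD; have [] := mP i.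
- by rewrite sA /= exprS invfM mulrA.
move=> i; exists (m i %% 2 ^ k)%N; rewrite ltn_mod expn_gt0; split=> //.
have [_ ->] := mP i; rewrite /= -addrA; congr (_ + _).
rewrite {1}(divn_eq (m i) (2 ^ k)) natrD mulrDl; congr (_ + _).
by rewrite sA exprS natrM natrX; field; rewrite expf_neq0.
Qed.

Variable D : set (cube R d).
Hypothesis D_dyadic : dyadic_lattice D.

Lemma dyadic_side_gt0 A : D A -> 0 < side A.
Proof. by have [h _ _ _] := D_dyadic; exact: h. Qed.

Lemma dyadic_descendant k A B : D B -> descendant k A B -> D A.
Proof.
have [_ h _ _] := D_dyadic.
elim: k A B => [|k IH] A B DB; first by move/descendant0 => ->.
by move=> /descendant_split[Q [/(h _ _ DB) DQ /(IH _ _ DQ)]].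
Qed.

(** Both cubes sit at integer positions in a common ancestor. The shared point confines the position
    of [A] to the range of positions covered by [B]. *)
Lemma dyadic_meet A B x : D A -> D B -> cubeset A x -> cubeset B x ->
  side A <= side B -> exists k, descendant k A B.
Proof.
move=> DA DB xA xB AB.
have [_ _ /(_ A B DA DB)[Q [DQ [[k [sA cA]] [l [sB cB]]]]] _] := D_dyadic.
have sQ := dyadic_side_gt0 DQ.
have sA0 := dyadic_side_gt0 DA.
have lk : (l <= k)%N.
  move: AB; rewrite sA sB ler_pM2l// lef_pV2 ?posrE ?exprn_gt0//.
  by rewrite ler_eXn2l// ltr1n.
have e : side B = 2 ^+ (k - l) * side A.
  rewrite sA sB -{2}(subnK lk) exprD; field.
  by rewrite !expf_neq0.
exists (k - l)%N; split; first by rewrite e mulrC mulKf// expf_neq0.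
move=> i; have [a [ak aE]] := cA i; have [b [bl bE]] := cB i.
have := xA i; have := xB i; rewrite aE bE e => /andP[b1 b2] /andP[a1 a2].
have h1 : (b * 2 ^ (k - l) <= a)%N.
  rewrite -ltnS -(ltr_nat R) -(ltr_pM2r sA0) -natr1 natrM natrX; nra.
have h2 : (a < b * 2 ^ (k - l) + 2 ^ (k - l))%N.
  rewrite -(ltr_nat R) -(ltr_pM2r sA0) natrD natrM natrX; nra.
exists (a - b * 2 ^ (k - l))%N; split; first by rewrite ltn_subLR.
rewrite natrB// natrM natrX; ring.
Qed.

End Descendants.

Lemma dyadic_scale (R : realType) (s : R) (k l : nat) : (k <= l)%N ->
  s / 2 ^+ k = (2 ^ (l - k))%:R * (s / 2 ^+ l).
Proof.
move=> kl; rewrite natrX.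
have -> : (2 : R) ^+ l = 2 ^+ (l - k) * 2 ^+ k by rewrite -exprD subnK.
by field; rewrite !expf_neq0.
Qed.

(** * The grid of generation [N] inside a cube *)

Section GridCubes.
Variables (d N : nat).
Let I := {ffun 'I_d -> 'I_(2 ^ N)}.
Implicit Type r : I.

(** A cell is given by its integer coordinates; dividing them by [2 ^ (N - k)] gives the coordinates
    of its ancestor of generation [k]. *)
Definition grid_rel (k : nat) : rel I :=
  fun r r' => [forall i, r i %/ 2 ^ (N - k) == r' i %/ 2 ^ (N - k)]%N.

Lemma grid_relP k r r' :
  reflect (forall i, r i %/ 2 ^ (N - k) = r' i %/ 2 ^ (N - k))%N (grid_rel k r r').
Proof. by apply: (iffP forallP) => h i; apply/eqP; move: (h i) => // /eqP. Qed.

Lemma grid_rel_equiv k : equivalence_rel (grid_rel k).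
Proof.
move=> r r' r''; split; first by apply/grid_relP.
by move=> /grid_relP h; apply/grid_relP/grid_relP => h' i; rewrite -?h' ?h.
Qed.

Lemma grid_rel_mono k k' r r' : (k <= k')%N -> grid_rel k' r r' -> grid_rel k r r'.
Proof.
move=> kk /grid_relP h; apply/grid_relP => i.
have -> : (2 ^ (N - k) = 2 ^ (N - k') * 2 ^ (N - k - (N - k')))%N.
  by rewrite -expnD; congr expn; lia.
by rewrite !divnMA h.
Qed.

Lemma grid_rel0 r r' : grid_rel 0 r r'.
Proof. by apply/grid_relP => i; rewrite subn0 !divn_small. Qed.

Variables (R : realType) (Q : cube R d).

Definition grid_cube (k : nat) (r : I) : cube R d :=
  Cube (fun i => corner Q i + (r i %/ 2 ^ (N - k))%:R * (side Q / 2 ^+ k)) (side Q / 2 ^+ k).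

Lemma grid_cube_rel k r r' : grid_rel k r r' -> grid_cube k r = grid_cube k r'.
Proof. by move=> /grid_relP h; apply: cube_eq => //= i; rewrite h. Qed.

Hypothesis Q_gt0 : 0 < side Q.

Lemma grid_cube_side_gt0 k r : 0 < side (grid_cube k r).
Proof. by rewrite /= divr_gt0// exprn_gt0. Qed.

Lemma grid_cube_descendant k l r : (k <= l)%N -> (l <= N)%N ->
  descendant (l - k) (grid_cube l r) (grid_cube k r).
Proof.
move=> kl lN; split=> /=.
  by rewrite -mulrA -invfM -exprD subnKC.
move=> i; exists ((r i %/ 2 ^ (N - l)) %% 2 ^ (l - k))%N.
rewrite ltn_mod expn_gt0; split=> //; rewrite -addrA; congr (_ + _).
have -> : (2 ^ (N - k) = 2 ^ (N - l) * 2 ^ (l - k))%N by rewrite -expnD; congr expn; lia.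
rewrite divnMA {1}(divn_eq (r i %/ 2 ^ (N - l)) (2 ^ (l - k))) natrD mulrDl.
by congr (_ + _); rewrite natrM -mulrA -dyadic_scale.
Qed.

Lemma grid_cube0 r : grid_cube 0 r = Q.
Proof.
apply: cube_eq => /= [|i]; first by rewrite divr1.
by rewrite subn0 divn_small// mul0r addr0.
Qed.

Lemma descendant_grid_cube k A : (k <= N)%N -> descendant k A Q ->
  exists r, A = grid_cube k r.
Proof.
move=> kN [sA /choice[m mP]].
have lt i : (m i * 2 ^ (N - k) < 2 ^ N)%N.
  have [h _] := mP i.
  by rewrite -{2}(subnKC kN) expnD ltn_pmul2r ?expn_gt0.
exists [ffun i => Ordinal (lt i)]; apply: cube_eq => //= i.
by have [_ ->] := mP i; rewrite sA ffunE/= mulnK ?expn_gt0.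
Qed.

(** [r0] is the cell of [x], found by truncating the coordinates of [x] in units of the cell side.
    Membership at every generation then becomes an equality of integer quotients. *)
Lemma grid_cube_mem x : cubeset Q x ->
  exists r0, forall k r, (k <= N)%N -> cubeset (grid_cube k r) x <-> grid_rel k r r0.
Proof.
move=> xQ; set u := side Q / 2 ^+ N.
have u0 : 0 < u by rewrite divr_gt0// exprn_gt0.
pose t i := (Defs.coord x i - corner Q i) / u.
have t0 i : 0 <= t i by have /andP[h _] := xQ i; rewrite divr_ge0 ?subr_ge0// ltW.
have lt i : (Num.truncn (t i) < 2 ^ N)%N.
  have /andP[_ h] := xQ i; rewrite ltnNge truncn_ge_nat// -ltNge.
  rewrite ltr_pdivrMr// natrX mulrC /u divfK ?expf_neq0//; lra.
exists [ffun i => Ordinal (lt i)] => k r kN.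
have key i : (corner Q i + (r i %/ 2 ^ (N - k))%:R * (side Q / 2 ^+ k) <= Defs.coord x i <
    corner Q i + (r i %/ 2 ^ (N - k))%:R * (side Q / 2 ^+ k) + side Q / 2 ^+ k)
    = (r i %/ 2 ^ (N - k) == Num.truncn (t i) %/ 2 ^ (N - k))%N.
  have -> : Defs.coord x i = corner Q i + t i * u by rewrite divfK ?gt_eqF// addrC subrK.
  rewrite (dyadic_scale _ kN) -/u.
  move: (r i %/ _)%N => q; rewrite -addrA lerD2l ltrD2l mulrA ler_pM2r//.
  rewrite -[X in _ < X]mulrDl ltr_pM2r// -[X in _ < _ + X]mul1r -[X in _ < X]mulrDl natr1.
  rewrite -!natrM -truncn_ge_nat// ltNge -truncn_ge_nat// -ltnNge.
  rewrite -leq_divRL ?expn_gt0// -ltn_divLR ?expn_gt0// ltnS eq_sym.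
  by rewrite eqn_leq andbC.
split=> [h|/grid_relP h i].
  apply/grid_relP => i; rewrite ffunE/=; apply/eqP; rewrite -key; exact: h.
by rewrite /= key h ffunE.
Qed.

Lemma grid_cube_sub k r : (k <= N)%N -> cubeset (grid_cube k r) `<=` cubeset Q.
Proof.
move=> kN; rewrite -[X in _ `<=` cubeset X](grid_cube0 r).
apply: (@descendant_subset _ _ (k - 0)); first exact: grid_cube_side_gt0.
exact: grid_cube_descendant.
Qed.

Lemma grid_cube_partition k r x : (k <= N)%N ->
  (x \in cubeset (grid_cube k r))%:R =
  \sum_(r' | grid_rel k r r') (x \in cubeset (grid_cube N r'))%:R :> R.
Proof.
move=> kN; have [xQ|xQ] := pselect (cubeset Q x); last first.
  rewrite (memNset (fun h => xQ (@grid_cube_sub _ _ kN _ h))) big1// => r' _.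
  by rewrite (memNset (fun h => xQ (@grid_cube_sub _ _ (leqnn _) _ h))).
have [r0 h] := grid_cube_mem xQ.
have memE l r' : (l <= N)%N -> (x \in cubeset (grid_cube l r')) = grid_rel l r' r0.
  by move=> lN; apply/idP/idP => [/set_mem/(h _ _ lN)//|/(h _ _ lN)/mem_set].
have eqN r' : grid_rel N r' r0 = (r' == r0).
  apply/grid_relP/eqP => [e|->//]; apply/ffunP => i; apply: val_inj.
  by have := e i; rewrite subnn !divn1.
rewrite memE//; under eq_bigr do rewrite memE// eqN.
rewrite big_mkcond (bigD1 r0)//= eqxx big1 ?addr0 => [|r' /negbTE ->].
  by case: ifP.
by case: ifP.
Qed.

Hypothesis d_gt0 : (0 < d)%N.

Lemma integrable_cube_cst (A : cube R d) (c : R) : 0 < side A ->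
  (leb R d).-integrable setT (EFin \o (cst c \_ (cubeset A))).
Proof.
move=> A0; rewrite -restrict_EFin.
apply: (integrable_mkcond _ (measurable_cubeset d_gt0 A)).1.
apply/integrableP; split; first by apply/measurable_EFinP; exact: measurable_cst.
under eq_integral do rewrite /=.
rewrite integral_cst; last exact: measurable_cubeset.
by rewrite [X in (_ * X)%E](leb_cubeset d_gt0 A0) -EFinM ltey.
Qed.

Lemma Rintegral_cube_cst (A : cube R d) (c : R) : 0 < side A ->
  Rintegral (leb R d) (cubeset A) (cst c) = c * vol A.
Proof.
move=> A0; rewrite Rintegral_cst; last exact: measurable_cubeset.
by rewrite [X in fine X](leb_cubeset d_gt0 A0).
Qed.

Lemma Rintegral_grid_cube k r (h : Rsp R d -> R) : (k <= N)%N ->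
  (leb R d).-integrable setT (EFin \o h) ->
  Rintegral (leb R d) (cubeset (grid_cube k r)) h =
  \sum_(r' | grid_rel k r r') Rintegral (leb R d) (cubeset (grid_cube N r')) h.
Proof.
move=> kN hi; apply: Rintegral_partition => //.
- exact: measurable_cubeset.
- by move=> r'; exact: measurable_cubeset.
- by move=> x; exact: grid_cube_partition.
Qed.

Lemma vol_gt0 (A : cube R d) : 0 < side A -> 0 < vol A.
Proof. exact: exprn_gt0. Qed.

Lemma vol_grid_cube k r : (k <= N)%N ->
  vol (grid_cube k r) = #|grid_rel k r|%:R * (side Q / 2 ^+ N) ^+ d.
Proof.
move=> kN.
have e l r' : (l <= N)%N -> Rintegral (leb R d) (cubeset (grid_cube l r'))
    (cst (1 : R) \_ (cubeset Q)) = vol (grid_cube l r').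
  move=> lN; rewrite -[RHS]mul1r -Rintegral_cube_cst ?grid_cube_side_gt0//.
  apply: eq_Rintegral => x /set_mem/(grid_cube_sub lN) xQ.
  by rewrite mem_set.
rewrite -e// (Rintegral_grid_cube _ kN); last exact: integrable_cube_cst.
rewrite (eq_bigr (fun=> (side Q / 2 ^+ N) ^+ d)) => [|r' _]; last by rewrite e.
by rewrite sumr_const mulr_natl.
Qed.

(** The cells are counted by comparing volumes: the volume of the cube is computed directly and as a
    sum over its cells. *)
Lemma grid_rel_card k r : (k <= N)%N -> #|grid_rel k r| = (2 ^ ((N - k) * d))%N.
Proof.
move=> kN; apply/eqP; rewrite -(eqr_nat R); apply/eqP.
have u0 : (side Q / 2 ^+ N) ^+ d != 0 by rewrite !(expf_neq0, mulf_neq0, invr_neq0)// gt_eqF.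
apply: (mulIf u0); rewrite -vol_grid_cube// /vol/= natrX exprM -exprMn.
by congr (_ ^+ _); rewrite (dyadic_scale _ kN) natrX.
Qed.

End GridCubes.

(** * Discretization of a dyadic shift *)

Section VectorIntegrals.
Context d (T : measurableType d) (R : realType) (mu : {measure set T -> \bar R}).
Variables (n p : nat) (f : T -> 'rV[R]_n) (M : 'M[R]_(n, p)).
Hypothesis fi : forall j, mu.-integrable setT (fun x => (f x ord0 j)%:E).

Let fMi i j : mu.-integrable setT (EFin \o (fun x => f x ord0 j * M j i)).
Proof. by have := integrableZr measurableT (M j i) (fi j); apply: eq_integrable. Qed.

Lemma integrable_mulmx i : mu.-integrable setT (EFin \o (fun x => (f x *m M) ord0 i)).
Proof.
rewrite (_ : _ \o _ = fun x => (\sum_j (EFin \o (fun x => f x ord0 j * M j i)%R) x)%E).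
  by apply: integrable_sum => // j _; exact: fMi.
by apply/funext => x; rewrite /= mxE sumEFin.
Qed.

Lemma Rintegral_mulmx (A : set T) i : measurable A ->
  Rintegral mu A (fun x => (f x *m M) ord0 i) =
  ((\row_j Rintegral mu A (fun x => f x ord0 j)) *m M) ord0 i.
Proof.
move=> mA; rewrite mxE; under eq_Rintegral do rewrite mxE.
rewrite Rintegral_sum//; last first.
  by move=> j; exact: (integrableS measurableT mA (@subsetT _ _) (fMi i j)).
apply: eq_bigr => j _; rewrite mxE RintegralZr//.
exact: (integrableS measurableT mA (@subsetT _ _) (fi j)).
Qed.
End VectorIntegrals.

Lemma Rintegral_norm_subset d (T : measurableType d) (R : realType)
    (mu : {measure set T -> \bar R}) (A B : set T) (h : T -> R) :
  measurable A -> measurable B -> A `<=` B -> mu.-integrable setT (EFin \o h) ->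
  Rintegral mu A (fun x => `|h x|) <= Rintegral mu B (fun x => `|h x|).
Proof.
move=> mA mB AB hi; have hn := integrable_norm hi.
rewrite [leLHS]Rintegral_mkcond [leRHS]Rintegral_mkcond.
apply: le_Rintegral => //; [exact: integrable_EFin_restrict|exact: integrable_EFin_restrict|].
move=> x _; rewrite !restrict_indic ler_wpM2l// ler_nat.
by case: (boolP (x \in A)) => // /set_mem/AB/mem_set ->.
Qed.

(** * Functions constant on the cells of a grid *)

Section StepFunctions.
Variables (R : realType) (d N : nat) (Q : cube R d).
Hypotheses (d_gt0 : (0 < d)%N) (Q_gt0 : 0 < side Q).
Let I := {ffun 'I_d -> 'I_(2 ^ N)}.
Implicit Type r : I.

Definition grid_cell r : cube R d := @grid_cube d N R Q N r.

Definition grid_vol : R := (side Q / 2 ^+ N) ^+ d.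

Lemma grid_vol_gt0 : 0 < grid_vol.
Proof. by rewrite exprn_gt0// divr_gt0// exprn_gt0. Qed.

Lemma grid_cell_inj r r' x : cubeset (grid_cell r) x -> cubeset (grid_cell r') x -> r = r'.
Proof.
move=> xr xr'.
have [r0 h] := grid_cube_mem N Q_gt0 (grid_cube_sub Q_gt0 (leqnn N) xr).
have /grid_relP e := (h N r (leqnn _)).1 xr.
have /grid_relP e' := (h N r' (leqnn _)).1 xr'.
apply/ffunP => i; apply: val_inj.
by have := e i; rewrite -(e' i) subnn !divn1.
Qed.

(** These are the test functions through which the [L^2] bound of the shift is carried over to the
    finite grid. *)
Definition step (u : I -> R) (x : Rsp R d) : R :=
  \sum_r (cst (u r) \_ (cubeset (grid_cell r))) x.

Lemma step_cell u r x : cubeset (grid_cell r) x -> step u x = u r.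
Proof.
move=> xr; rewrite /step (bigD1 r)//= big1 ?addr0 => [|r' /eqP r'r].
  by rewrite restrict_indic mem_set//= mulr1.
by rewrite restrict_indic memNset ?mulr0// => xr'; apply/r'r/(grid_cell_inj xr' xr).
Qed.

Lemma step_sqr u x : step u x ^+ 2 = step (fun r => u r ^+ 2) x.
Proof.
have [[r xr]|h] := pselect (exists r, cubeset (grid_cell r) x).
  by rewrite !(step_cell _ xr).
have e v : step v x = 0.
  rewrite /step big1// => r _.
  by rewrite restrict_indic memNset ?mulr0// => xr; apply: h; exists r.
by rewrite !e expr0n.
Qed.

Lemma integrable_step u : (leb R d).-integrable setT (EFin \o step u).
Proof.
rewrite (_ : _ \o _ =
    fun x => (\sum_r (EFin \o (cst (u r) \_ (cubeset (grid_cell r)))%R) x)%E).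
  apply: integrable_sum => // r _; apply: integrable_cube_cst => //.
  exact: grid_cube_side_gt0.
by apply/funext => x; rewrite /= /step sumEFin.
Qed.

Lemma Rintegral_step_cell u r :
  Rintegral (leb R d) (cubeset (grid_cell r)) (step u) = grid_vol * u r.
Proof.
rewrite mulrC -[grid_vol]/(vol (grid_cell r)) -Rintegral_cube_cst ?grid_cube_side_gt0//.
by apply: eq_Rintegral => x /set_mem xr; exact: step_cell xr.
Qed.

Lemma Rintegral_step u : Rintegral (leb R d) setT (step u) = grid_vol * \sum_r u r.
Proof.
rewrite Rintegral_sum//; last first.
  by move=> r; apply: integrable_cube_cst => //; exact: grid_cube_side_gt0.
rewrite mulr_sumr; apply: eq_bigr => r _.
rewrite -Rintegral_mkcond Rintegral_cube_cst ?grid_cube_side_gt0//.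
by rewrite mulrC.
Qed.

Lemma L2_step u : L2 (step u).
Proof.
split; first by apply/measurable_EFinP; exact: measurable_int (integrable_step u).
under eq_integral do rewrite step_sqr.
exact: integrable_lty (integrable_step _).
Qed.

Lemma norm2_step u : norm2 (step u) = Num.sqrt grid_vol * Num.sqrt (\sum_r u r ^+ 2).
Proof.
rewrite /norm2; under eq_Rintegral do rewrite step_sqr.
by rewrite Rintegral_step sqrtrM// ltW// grid_vol_gt0.
Qed.
End StepFunctions.

Lemma dyadic_common_ancestor (R : realType) (d : nat) (D : set (cube R d)) (T : seq (cube R d)) :
  dyadic_lattice D -> T != [::] -> (forall Q, Q \in T -> D Q) ->
  exists P, D P /\ forall Q, Q \in T -> exists k, descendant k Q P.
Proof.
move=> Ddy; case: T => // Q0 T _; elim: T => [|Q T IH] TD.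
  exists Q0; split; first by apply: TD; exact: mem_head.
  by move=> Q; rewrite inE => /eqP ->; exists 0%N; exact: descendant_refl.
have [P [DP PT]] : exists P, D P /\ forall Q, Q \in Q0 :: T -> exists k, descendant k Q P.
  by apply: IH => A AT; apply: TD; rewrite inE in AT; rewrite !inE; case/orP: AT => ->; rewrite ?orbT.
have DQ : D Q by apply: TD; rewrite !inE eqxx orbT.
have [_ _ /(_ P Q DP DQ)[P' [DP' [[k kP] [l lQ]]]] _] := Ddy.
exists P'; split=> // A; rewrite !inE => /or3P[AQ0|/eqP ->|AT].
- have [|m mA] := PT A; first by rewrite inE AQ0.
  by exists (m + k)%N; exact: descendant_trans mA kP.
- by exists l.
- have [|m mA] := PT A; first by rewrite inE AT orbT.
  by exists (m + k)%N; exact: descendant_trans mA kP.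
Qed.

(** * The vector form over a finite block of cubes *)

Section Block.
Variables (R : realType) (d n : nat) (D : set (cube R d)) (m1 m2 : nat).
Variable s : cube R d -> Rsp R d -> Rsp R d -> R.
Hypotheses (d_gt0 : (0 < d)%N) (D_dyadic : dyadic_lattice D).
Hypothesis s_shift : dyadic_shift D m1 m2 s.

Definition shift_term (Q : cube R d) (g1 g2 : Rsp R d -> R) : R :=
  Rintegral (prodSF (leb R d) (leb R d)) (cubeset Q `*` cubeset Q)
    (fun z => s Q z.1 z.2 * g1 z.1 * g2 z.2).

Section Discretization.
Variables (N : nat) (P : cube R d) (T : seq (cube R d)) (l : cube R d -> nat).
Let I := {ffun 'I_d -> 'I_(2 ^ N)}.
Variable c : cube R d -> I.
Hypotheses (DP : D P) (T_uniq : uniq T).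
Hypothesis l_lt : forall Q, Q \in T -> (l Q + m1 + m2 < N)%N.
Hypothesis T_grid : forall Q, Q \in T -> Q = grid_cube P (l Q) (c Q).

Let P_gt0 : 0 < side P. Proof. exact: dyadic_side_gt0 DP. Qed.

Let cell := @grid_cell R d N P.
Let w := @grid_vol R d N P.
Let pt r : Rsp R d := sval (corner_point d_gt0 (cell r)).

Let grid_D k r : (k <= N)%N -> D (grid_cube (N:=N) P k r).
Proof.
move=> kN; apply: (dyadic_descendant D_dyadic DP (k := k - 0)).
rewrite -[X in descendant _ _ X](grid_cube0 P r).
exact: grid_cube_descendant.
Qed.

Let lN Q : Q \in T -> (l Q < N)%N.
Proof. by move=> /l_lt; lia. Qed.

Let T_D Q : Q \in T -> D Q.
Proof. by move=> QT; rewrite (T_grid QT); apply/grid_D/ltnW/lN. Qed.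

Let pt_cell r : cubeset (cell r) (pt r).
Proof.
move=> i; rewrite /pt; case: corner_point => x /= ->.
by rewrite lexx ltrDl (grid_cube_side_gt0 P_gt0 N r).
Qed.

Let cell_sub k r r' : (k <= N)%N -> grid_rel k r r' ->
  cubeset (cell r') `<=` cubeset (grid_cube P k r).
Proof.
move=> kN /(grid_cube_rel P) ->.
apply: (@descendant_subset _ _ (N - k)); first exact: grid_cube_side_gt0.
exact: grid_cube_descendant.
Qed.

Let side_lt Q k m r : Q \in T -> (l Q + m < k)%N ->
  side (grid_cube (N:=N) P k r) < side Q / 2 ^+ m.
Proof.
move=> QT lk; rewrite (T_grid QT) /= -mulrA -invfM -exprD ltr_pM2l//.
by rewrite ltf_pV2 ?posrE ?exprn_gt0// ltr_eXn2l// ltr1n.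
Qed.

Let grid_sub Q k r : Q \in T -> (l Q <= k)%N -> (k <= N)%N -> grid_rel (l Q) (c Q) r ->
  cubeset (grid_cube (N:=N) P k r) `<=` cubeset Q.
Proof.
move=> QT lk kN h; rewrite [X in _ `<=` cubeset X](T_grid QT) (grid_cube_rel P h).
apply: (@descendant_subset _ _ (k - l Q)); first exact: grid_cube_side_gt0.
exact: grid_cube_descendant.
Qed.

Let s_cst1 Q k r x x' y : Q \in T -> (l Q + m1 < k)%N -> (k <= N)%N ->
  grid_rel (l Q) (c Q) r -> cubeset (grid_cube (N:=N) P k r) x ->
  cubeset (grid_cube (N:=N) P k r) x' -> cubeset Q y -> s Q x y = s Q x' y.
Proof.
move=> QT lk kN h xr xr' yQ; have [_ _ h3] := s_shift.
have sub : cubeset (grid_cube (N:=N) P k r) `<=` cubeset Q.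
  by apply: grid_sub => //; lia.
have [h1 _] := h3 Q _ (T_D QT) (grid_D r kN) sub.
exact: (h1 (side_lt r QT lk) y yQ x x' xr xr').
Qed.

Let s_cst2 Q k r x y y' : Q \in T -> (l Q + m2 < k)%N -> (k <= N)%N ->
  grid_rel (l Q) (c Q) r -> cubeset (grid_cube (N:=N) P k r) y ->
  cubeset (grid_cube (N:=N) P k r) y' -> cubeset Q x -> s Q x y = s Q x y'.
Proof.
move=> QT lk kN h yr yr' xQ; have [_ _ h3] := s_shift.
have sub : cubeset (grid_cube (N:=N) P k r) `<=` cubeset Q.
  by apply: grid_sub => //; lia.
have [_ h2] := h3 Q _ (T_D QT) (grid_D r kN) sub.
exact: (h2 (side_lt r QT lk) x xQ y y' yr yr').
Qed.

Let cell_Q Q r : Q \in T -> grid_rel (l Q) (c Q) r -> cubeset (cell r) `<=` cubeset Q.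
Proof. by move=> QT h; apply: grid_sub => //; exact/ltnW/lN. Qed.

Let shift_termE Q (h1 h2 : Rsp R d -> R) : Q \in T ->
  (leb R d).-integrable setT (EFin \o h1) -> (leb R d).-integrable setT (EFin \o h2) ->
  shift_term Q h1 h2 =
  \sum_(r | grid_rel (l Q) (c Q) r) \sum_(r' | grid_rel (l Q) (c Q) r')
    s Q (pt r) (pt r') * Rintegral (leb R d) (cubeset (cell r)) h1 *
      Rintegral (leb R d) (cubeset (cell r')) h2.
Proof.
move=> QT h1i h2i; apply: Rintegral_prod_cells => //.
- by move=> r; exact: measurable_cubeset.
- by move=> x; rewrite {1}(T_grid QT); apply: grid_cube_partition => //; exact/ltnW/lN.
- move=> r r' x y hr hr' xr yr'.
  transitivity (s Q (pt r) y).
    apply: (s_cst1 (k := N) (r := r)) => //; first by have := l_lt QT; lia.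
    by apply: (cell_Q QT hr').
  apply: (s_cst2 (k := N) (r := r')) => //; first by have := l_lt QT; lia.
  exact: (cell_Q QT hr).
Qed.

(** Replacing two integrals by cell means produces [w ^+ 2]. One factor [w] goes here, so that the
    size bound becomes the inverse of a number of cells; the other stays in front of the form. *)
Let sig (Q : cube R d) r r' : R := w * s Q (pt r) (pt r').

Let w_gt0 : 0 < w. Proof. exact: grid_vol_gt0. Qed.

Definition cell_mean (h : Rsp R d -> R) (r : I) : R :=
  w^-1 * Rintegral (leb R d) (cubeset (cell r)) h.

Lemma shift_terms_grid (h1 h2 : Rsp R d -> R) :
  (leb R d).-integrable setT (EFin \o h1) -> (leb R d).-integrable setT (EFin \o h2) ->
  \sum_(Q <- T) shift_term Q h1 h2 =
  w * grid_form R I _ (@grid_rel d N) T l c sig (cell_mean h1) (cell_mean h2).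
Proof.
move=> h1i h2i; rewrite /grid_form mulr_sumr big_seq [RHS]big_seq.
apply: eq_bigr => Q QT; rewrite shift_termE// mulr_sumr; apply: eq_bigr => r _.
rewrite mulr_sumr; apply: eq_bigr => r' _.
rewrite /sig /cell_mean; field; exact: lt0r_neq0.
Qed.

(** The bound (A2) for the subcollection [T] is tested on step functions. Their cell means are [u]
    and [v], and their norms give back exactly the factor [w] in front of the form. *)
Let sig_L2 u v : `|grid_form R I _ (@grid_rel d N) T l c sig u v| <=
  Num.sqrt (\sum_r u r ^+ 2) * Num.sqrt (\sum_r v r ^+ 2).
Proof.
have cm z r : cell_mean (step P z) r = z r.
  by rewrite /cell_mean Rintegral_step_cell// mulKf// lt0r_neq0.
have [_ A2 _] := s_shift.
have := A2 [set` T] _ (step P u) (step P v) (L2_step d_gt0 P_gt0 u) (L2_step d_gt0 P_gt0 v).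
have -> : shift_form s [set` T] (step P u) (step P v) =
    \sum_(Q <- T) shift_term Q (step P u) (step P v) by rewrite /shift_form -fsbig_seq.
rewrite shift_terms_grid; [|exact: integrable_step|exact: integrable_step].
rewrite (funext (cm u)) (funext (cm v)) !norm2_step// mulrACA -expr2 (sqr_sqrtr (ltW w_gt0)).
rewrite -/w normrM gtr0_norm// ler_pM2l//; apply.
by move=> Q; exact: T_D.
Qed.

Let sig_bound Q r r' : Q \in T -> grid_rel (l Q) (c Q) r -> grid_rel (l Q) (c Q) r' ->
  `|sig Q r r'| <= #|grid_rel (l Q) (c Q)|%:R^-1.
Proof.
move=> QT hr hr'; have [[_ A1] _ _] := s_shift.
have := A1 Q (T_D QT) _ _ (cell_Q QT hr (pt_cell r)) (cell_Q QT hr' (pt_cell r')).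
rewrite {2}(T_grid QT) vol_grid_cube//; last exact/ltnW/lN.
rewrite -[(_ / _) ^+ _]/w invfM => h.
rewrite /sig normrM gtr0_norm// mulrC -ler_pdivlMr//.
Qed.

Lemma grid_abs_mean k r (h : Rsp R d -> R) : (k <= N)%N ->
  (leb R d).-integrable setT (EFin \o h) ->
  \sum_(r' | grid_rel k r r') `|cell_mean h r'| <=
  w^-1 * Rintegral (leb R d) (cubeset (grid_cube P k r)) (fun x => `|h x|).
Proof.
move=> kN hi; rewrite Rintegral_grid_cube//; last exact: (integrable_norm hi).
rewrite mulr_sumr; apply: ler_sum => r' _.
rewrite /cell_mean normrM gtr0_norm ?invr_gt0// ler_pM2l ?invr_gt0//.
apply: le_normr_Rintegral; first exact: measurable_cubeset.
exact: (integrableS measurableT (measurable_cubeset d_gt0 _) (@subsetT _ _) hi).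
Qed.

Let r0 : I := [ffun=> Ordinal (expn_gt0 2 N : (0 < 2 ^ N)%N)].

(** An open class is a lattice cube with a descendant in [T], which is where the means are
    controlled by hypothesis. [V / w] is the volume counted in cells. *)
Lemma grid_block_bound (h1 h2 : Rsp R d -> R) (F G V : R) :
  (leb R d).-integrable setT (EFin \o h1) -> (leb R d).-integrable setT (EFin \o h2) ->
  0 <= F -> 0 <= G -> 0 <= V ->
  (forall A Q k, D A -> Q \in T -> descendant k Q A ->
    Rintegral (leb R d) (cubeset A) (fun x => `|h1 x|) <= F * vol A /\
    Rintegral (leb R d) (cubeset A) (fun x => `|h2 x|) <= G * vol A) ->
  Rintegral (leb R d) setT (fun x => `|h1 x|) <= F * V ->
  Rintegral (leb R d) setT (fun x => `|h2 x|) <= G * V ->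
  `|w * grid_form R I _ (@grid_rel d N) T l c sig (cell_mean h1) (cell_mean h2)| <=
    (2 ^ d + 2 * m1 + 2 * 2 ^ d * m2)%:R * (F * G * V).
Proof.
move=> h1i h2i F0 G0 V0 hA h1V h2V.
have openE k r (h : Rsp R d -> R) X : (leb R d).-integrable setT (EFin \o h) ->
    (forall A Q k, D A -> Q \in T -> descendant k Q A ->
      Rintegral (leb R d) (cubeset A) (fun x => `|h x|) <= X * vol A) ->
    grid_open I _ (@grid_rel d N) T l c k r ->
    \sum_(r' | grid_rel k r r') `|cell_mean h r'| <= X * #|grid_rel k r|%:R.
  move=> hi hX /hasP[Q QT /andP[kl Ek]].
  have lQ := lN QT; have kN : (k <= N)%N := leq_trans kl (ltnW lQ).
  apply: le_trans (grid_abs_mean _ kN hi) _; rewrite mulrC ler_pdivrMr//.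
  rewrite -mulrA -vol_grid_cube//; apply: (hX _ Q (l Q - k)%N) => //; first exact: grid_D.
  rewrite [X in descendant _ X _](T_grid QT) -(grid_cube_rel P Ek); apply: grid_cube_descendant => //.
  exact: ltnW.
have sumE (h : Rsp R d -> R) X : (leb R d).-integrable setT (EFin \o h) ->
    Rintegral (leb R d) setT (fun x => `|h x|) <= X * V ->
    \sum_r `|cell_mean h r| <= X * (V / w).
  move=> hi hV.
  rewrite (eq_bigl (grid_rel 0 r0)); last by move=> r; rewrite grid_rel0.
  apply: le_trans (grid_abs_mean _ (leq0n N) hi) _.
  rewrite mulrC mulrA ler_pM2r ?invr_gt0//; apply: le_trans hV.
  by apply: Rintegral_norm_subset => //; exact: measurable_cubeset.
have := @grid_form_bound R I _ N (2 ^ d)%N (@grid_rel d N) T l c _ _ _ _ _ _ _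
  sig m1 m2 (cell_mean h1) (cell_mean h2) F G (V / w).
rewrite normrM gtr0_norm// => H.
apply: (@le_trans _ _ (w * ((2 ^ d + 2 * m1 + 2 * 2 ^ d * m2)%:R * (F * G * (V / w))))).
  rewrite ler_pM2l//; apply: H => //.
  - exact: grid_rel_equiv.
  - by move=> k k' r r'; exact: grid_rel_mono.
  - exact: grid_rel0.
  - move=> k r kN; rewrite !(grid_rel_card P_gt0 d_gt0)//; last exact: ltnW.
    by rewrite -expnD leq_exp2l// -mulSn subnSK.
  - move=> Q Q' QT QT' e h; rewrite (T_grid QT) (T_grid QT') -e.
    exact: grid_cube_rel.
  - move=> Q r r1 r' k QT hr hr1 hr' lk kN Ek; congr (_ * _).
    apply: (s_cst1 (k := k) (r := r)) => //.
    + by apply: (cell_sub kN _ (pt_cell _)); have [] := grid_rel_equiv k r r r.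
    + exact: (cell_sub kN Ek (pt_cell _)).
    + exact: (cell_Q QT hr' (pt_cell _)).
  - move=> Q r r1 r' k QT hr hr1 hr' lk kN Ek; congr (_ * _).
    apply: (s_cst2 (k := k) (r := r)) => //.
    + by apply: (cell_sub kN _ (pt_cell _)); have [] := grid_rel_equiv k r r r.
    + exact: (cell_sub kN Ek (pt_cell _)).
    + exact: (cell_Q QT hr' (pt_cell _)).
  - by rewrite divr_ge0// ltW.
  - by move=> k r; apply: openE => // A Q j DA QT /(hA _ _ _ DA QT)[].
  - by move=> k r; apply: openE => // A Q j DA QT /(hA _ _ _ DA QT)[].
  - exact: sumE.
  - exact: sumE.
have -> : w * ((2 ^ d + 2 * m1 + 2 * 2 ^ d * m2)%:R * (F * G * (V / w))) =
    (2 ^ d + 2 * m1 + 2 * 2 ^ d * m2)%:R * (F * G * V).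
  by move: (_%:R) => X; field; exact: lt0r_neq0.
by [].
Qed.

Let integral_row (n' : nat) (f : Rsp R d -> 'rV[R]_n') (A : cube R d) : 'rV[R]_n' :=
  \row_j Rintegral (leb R d) (cubeset A) (fun x => f x ord0 j).

(** After discretization the form only sees integrals over cells. For these vectors [x W U = x],
    hence [x . y = (x W) . (y U^T)], and no pointwise identity for [f1] is required. *)
Lemma grid_vector_bound (f1 f2 : Rsp R d -> 'rV[R]_n) (W U : 'M[R]_n)
    (F G : 'I_n -> R) (V : R) :
  L1vec f1 -> L1vec f2 ->
  (forall A, D A -> integral_row f1 A *m W *m U = integral_row f1 A) ->
  (forall i, 0 <= F i) -> (forall i, 0 <= G i) -> 0 <= V ->
  (forall i A Q k, D A -> Q \in T -> descendant k Q A ->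
    Rintegral (leb R d) (cubeset A) (fun x => `|(f1 x *m W) ord0 i|) <= F i * vol A /\
    Rintegral (leb R d) (cubeset A) (fun x => `|(f2 x *m U^T) ord0 i|) <= G i * vol A) ->
  (forall i, Rintegral (leb R d) setT (fun x => `|(f1 x *m W) ord0 i|) <= F i * V) ->
  (forall i, Rintegral (leb R d) setT (fun x => `|(f2 x *m U^T) ord0 i|) <= G i * V) ->
  `|\sum_j \sum_(Q <- T) shift_term Q (fun x => f1 x ord0 j) (fun x => f2 x ord0 j)| <=
    (2 ^ d + 2 * m1 + 2 * 2 ^ d * m2)%:R * \sum_i (F i * G i * V).
Proof.
move=> f1i f2i WU F0 G0 V0 hA h1V h2V.
have gE m (a b : 'I_m -> I -> R) :
    \sum_j grid_form R I _ (@grid_rel d N) T l c sig (a j) (b j) =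
    \sum_(Q <- T) \sum_(r | grid_rel (l Q) (c Q) r) \sum_(r' | grid_rel (l Q) (c Q) r')
      sig Q r r' * \sum_j a j r * b j r'.
  rewrite exchange_big/=; apply: eq_bigr => Q _.
  rewrite exchange_big/=; apply: eq_bigr => r _.
  rewrite exchange_big/=; apply: eq_bigr => r' _.
  by rewrite mulr_sumr; apply: eq_bigr => j _; rewrite mulrA.
have -> : \sum_j \sum_(Q <- T) shift_term Q (fun x => f1 x ord0 j) (fun x => f2 x ord0 j) =
    \sum_i w * grid_form R I _ (@grid_rel d N) T l c sig
      (cell_mean (fun x => (f1 x *m W) ord0 i)) (cell_mean (fun x => (f2 x *m U^T) ord0 i)).
  rewrite (eq_bigr _ (fun j _ => shift_terms_grid (f1i j) (f2i j))) -!mulr_sumr.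
  congr (_ * _); rewrite !gE.
  apply: eq_bigr => Q _; apply: eq_bigr => r _; apply: eq_bigr => r' _; congr (_ * _).
  pose x := integral_row f1 (cell r); pose y := integral_row f2 (cell r').
  transitivity ((w^-1 *: x *m (w^-1 *: y)^T) ord0 ord0).
    by rewrite [RHS]mxE; apply: eq_bigr => j _; rewrite !mxE.
  have xE : w^-1 *: x = (w^-1 *: (x *m W)) *m U by rewrite -scalemxAl WU//; exact: grid_D.
  rewrite xE -mulmxA -[U in LHS]trmxK -trmx_mul [LHS]mxE.
  apply: eq_bigr => i _.
  rewrite [X in _ * X]mxE -scalemxAl [X in X * _]mxE [X in _ * X]mxE.
  by rewrite /cell_mean !Rintegral_mulmx//; exact: measurable_cubeset.
apply: le_trans (ler_norm_sum _ _ _) _; rewrite mulr_sumr; apply: ler_sum => i _.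
apply: grid_block_bound => //.
- exact: integrable_mulmx.
- exact: integrable_mulmx.
- by move=> A Q k; exact: hA.
Qed.

End Discretization.

(** The common ancestor and the depth of the grid are auxiliary choices; neither enters the
    bound. *)
Lemma shift_block_bound (T : seq (cube R d)) (f1 f2 : Rsp R d -> 'rV[R]_n)
    (W U : 'M[R]_n) (F G : 'I_n -> R) (V : R) :
  uniq T -> (forall Q, Q \in T -> D Q) -> L1vec f1 -> L1vec f2 ->
  (forall A, D A ->
    let v := \row_j Rintegral (leb R d) (cubeset A) (fun x => f1 x ord0 j) in
    v *m W *m U = v) ->
  (forall i, 0 <= F i) -> (forall i, 0 <= G i) -> 0 <= V ->
  (forall i A Q k, D A -> Q \in T -> descendant k Q A ->
    Rintegral (leb R d) (cubeset A) (fun x => `|(f1 x *m W) ord0 i|) <= F i * vol A /\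
    Rintegral (leb R d) (cubeset A) (fun x => `|(f2 x *m U^T) ord0 i|) <= G i * vol A) ->
  (forall i, Rintegral (leb R d) setT (fun x => `|(f1 x *m W) ord0 i|) <= F i * V) ->
  (forall i, Rintegral (leb R d) setT (fun x => `|(f2 x *m U^T) ord0 i|) <= G i * V) ->
  `|\sum_j \sum_(Q <- T) shift_term Q (fun x => f1 x ord0 j) (fun x => f2 x ord0 j)| <=
    (2 ^ d + 2 * m1 + 2 * 2 ^ d * m2)%:R * \sum_i (F i * G i * V).
Proof.
move=> T_uniq TD f1i f2i WU F0 G0 V0 hA h1V h2V.
have [T0|T0] := eqVneq T [::].
  rewrite [X in `|X|]big1 ?normr0 => [|j _]; last by rewrite T0 big_nil.
  by rewrite mulr_ge0 ?ler0n// sumr_ge0// => i _; rewrite !mulr_ge0.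
have [P [DP PT]] := dyadic_common_ancestor D_dyadic T0 TD.
have P_gt0 : 0 < side P by exact: dyadic_side_gt0 DP.
have [l lP] : exists l, forall Q, Q \in T -> descendant (l Q) Q P.
  suff /choice[l lP] : forall Q, exists k, Q \in T -> descendant k Q P by exists l.
  move=> Q; have [QT|] := boolP (Q \in T); last by exists 0%N.
  by have [k kP] := PT _ QT; exists k.
(* With this depth, cells lie more than [m1] and more than [m2] generations below each cube of [T],
   so every kernel is constant on them in both variables. *)
pose N := (\max_(Q <- T) l Q + m1 + m2).+1.
have l_lt Q : Q \in T -> (l Q + m1 + m2 < N)%N.
  by move=> QT; rewrite ltnS !leq_add2r; exact: (leq_bigmax_seq Q QT isT).
have [c cP] : exists c : cube R d -> {ffun 'I_d -> 'I_(2 ^ N)},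
    forall Q, Q \in T -> Q = grid_cube P (l Q) (c Q).
  suff /choice[c cP] : forall Q, exists r : {ffun 'I_d -> 'I_(2 ^ N)},
      Q \in T -> Q = grid_cube P (l Q) r by exists c.
  move=> Q; have [QT|] := boolP (Q \in T); last first.
    by exists [ffun=> Ordinal (expn_gt0 2 N : (0 < 2 ^ N)%N)].
  have lN : (l Q <= N)%N by have := l_lt _ QT; lia.
  by have [r rE] := descendant_grid_cube lN (lP _ QT); exists r.
apply: (@grid_vector_bound N P T l c) => //; [by move=> A DA; exact: WU|].
by move=> i A Q k; exact: hA.
Qed.

End Block.

(** * Convex body averages *)

Section Average.
Variables (R : realType) (d n : nat) (f : Rsp R d -> 'rV[R]_n) (Q : cube R d).
Hypotheses (d_gt0 : (0 < d)%N) (fi : L1vec f) (Q_gt0 : 0 < side Q).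
Let mu := leb R d.

Let fphi_int j phi : Phi Q phi -> mu.-integrable setT (EFin \o (fun x => f x ord0 j * phi x)).
Proof.
move=> [mphi phi1 _]; apply: le_integrable (fi j) => //.
  apply/measurable_EFinP; apply: measurable_funM => //.
  by apply/measurable_EFinP; exact: measurable_int (fi j).
move=> x _; rewrite /= lee_fin normrM; apply: ler_piMr => //.
Qed.

Let mean_row (phi : Rsp R d -> R) : 'rV[R]_n :=
  \row_j ((vol Q)^-1 * Rintegral mu setT (fun x => f x ord0 j * phi x)).

Lemma avg_bound k j : avg f Q k ->
  `|k ord0 j| <= \sum_i ((vol Q)^-1 * Rintegral mu setT (fun x => `|f x ord0 i|)).
Proof.
move=> [phi Pphi ->]; rewrite mxE normrM ger0_norm ?invr_ge0 ?exprn_ge0 ?(ltW Q_gt0)//.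
apply: (@le_trans _ _ ((vol Q)^-1 * Rintegral mu setT (fun x => `|f x ord0 j|))).
  rewrite ler_wpM2l ?invr_ge0 ?exprn_ge0 ?(ltW Q_gt0)//.
  apply: le_trans (le_normr_Rintegral measurableT (fphi_int j Pphi)) _.
  apply: le_Rintegral => //.
  - exact: (integrable_norm (fphi_int j Pphi)).
  - exact: (integrable_norm (fi j)).
  - by move=> x _; have [_ h _] := Pphi; rewrite normrM ler_piMr.
rewrite (bigD1 j)//= lerDl sumr_ge0// => i _.
by rewrite mulr_ge0 ?invr_ge0 ?exprn_ge0 ?(ltW Q_gt0)// Rintegral_ge0.
Qed.

Lemma avg0 : avg f Q 0.
Proof.
exists (fun=> 0).
  by split=> // x; rewrite normr0 ler01.
apply/rowP => j; rewrite !mxE; under eq_Rintegral do rewrite mulr0.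
by rewrite Rintegral_cst// mul0r mulr0.
Qed.

Lemma avg_conv k h a b : avg f Q k -> avg f Q h -> `|a| + `|b| <= 1 ->
  avg f Q (a *: k + b *: h).
Proof.
move=> [phi Pphi ->] [psi Ppsi ->] ab; exists (fun x => a * phi x + b * psi x).
  have [mphi phi1 phi0] := Pphi; have [mpsi psi1 psi0] := Ppsi; split.
  - by apply: measurable_funD; apply: measurable_funM => //; exact: measurable_cst.
  - move=> x; apply: le_trans (ler_normD _ _) _; apply: le_trans ab; rewrite !normrM.
    by apply: lerD; rewrite ler_piMr.
  - by move=> x xQ; rewrite phi0// psi0// !mulr0 addr0.
apply/rowP => j; rewrite !mxE.
have e c g : Phi Q g -> Rintegral mu setT (fun x => c * (f x ord0 j * g x)) =
    c * Rintegral mu setT (fun x => f x ord0 j * g x).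
  by move=> Pg; rewrite RintegralZl//; exact: fphi_int.
have ei c g : Phi Q g -> mu.-integrable setT (EFin \o (fun x => c * (f x ord0 j * g x))).
  by move=> Pg; have := integrableZl measurableT c (fphi_int j Pg); apply: eq_integrable.
transitivity ((vol Q)^-1 * Rintegral mu setT
    (fun x => a * (f x ord0 j * phi x) + b * (f x ord0 j * psi x))).
  by rewrite RintegralD// ?e//; [ring|exact: ei|exact: ei].
by congr (_ * _); apply: eq_Rintegral => x _; ring.
Qed.

(** The test function is the indicator of the part of [A] inside [Q]. This transfers the frame
    identity on [<f>_Q] to integrals of the truncated function over arbitrary cubes. *)
Lemma avg_subset (A : set (Rsp R d)) : measurable A ->
  avg f Q ((vol Q)^-1 *: \row_j Rintegral mu A
     (fun x => ((x \in cubeset Q)%:R *: f x) ord0 j)).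
Proof.
move=> mA; exists (\1_(A `&` cubeset Q)).
  split.
  - by apply: measurable_indic; apply: measurableI => //; exact: measurable_cubeset.
  - by move=> x; rewrite indicE; case: (_ \in _); rewrite ?normr0 ?normr1// ler01.
  - by move=> x xQ; rewrite indicE memNset// => -[].
apply/rowP => j; rewrite !mxE; congr (_ * _); rewrite Rintegral_mkcond restrict_indic.
by apply: eq_Rintegral => x _; rewrite indicE in_setI mxE -mulnb natrM; ring.
Qed.

(* The average of [|f M|_i] is attained in [<f>_Q] by testing against its sign. *)
Lemma avg_sign p (M : 'M[R]_(n, p)) i : exists2 k, avg f Q k &
  (k *m M) ord0 i = (vol Q)^-1 * Rintegral mu (cubeset Q) (fun x => `|(f x *m M) ord0 i|).
Proof.
pose h x := (f x *m M) ord0 i.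
have mh : measurable_fun setT h.
  by apply/measurable_EFinP; exact: measurable_int (integrable_mulmx M fi i).
pose A := h @^-1` `[0, +oo[%classic.
have mA : measurable A.
  by rewrite -[A]setTI; apply: mh => //; exact: measurable_itv.
(* The sign of [h], taken as [1] where [h] vanishes, cut off to [Q]. *)
pose phi x : R := (2 * \1_A x - 1) * \1_(cubeset Q) x.
have Pphi : Phi Q phi.
  split.
  - apply: measurable_funM; last by apply: measurable_indic; exact: measurable_cubeset.
    apply: measurable_funB; last exact: measurable_cst.
    by apply: measurable_funM; [exact: measurable_cst|exact: measurable_indic].
  - move=> x; rewrite /phi !indicE; case: (_ \in _); case: (_ \in _);
      rewrite ?(mulr0, mulr1, sub0r, normrN, normr0, normr1)// ?ler01//.
    by rewrite -[2]/(1 + 1) addrK normr1.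
  - by move=> x xQ; rewrite /phi !indicE (memNset xQ) mulr0.
exists (mean_row phi); first by exists phi.
have -> : mean_row phi = (vol Q)^-1 *:
    \row_j Rintegral mu setT (fun x => ((phi x) *: f x) ord0 j).
  apply/rowP => j; rewrite !mxE; congr (_ * _).
  by apply: eq_Rintegral => x _; rewrite mxE mulrC.
rewrite -scalemxAl mxE; congr (_ * _); rewrite -Rintegral_mulmx//; last first.
  move=> j; have := fphi_int j Pphi; apply: eq_integrable => // x _.
  by rewrite /= mxE mulrC.
rewrite [RHS]Rintegral_mkcond restrict_indic; apply: eq_Rintegral => x _.
rewrite -scalemxAl mxE /phi !indicE -/(h x).
rewrite mulrAC mulrC [LHS]mulrC; congr (_ * _).
have -> : (x \in A) = (0 <= h x).
  by apply/idP/idP => [/set_mem|h0]; [|apply/mem_set]; rewrite /A/= in_itv/= ?h0// => /andP[].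
case: (lerP 0 (h x)) => hx; [rewrite ger0_norm|rewrite ltr0_norm]; rewrite // ?mulr0 ?mulr1; ring.
Qed.

End Average.

Section Setprod.
Variables (R : realType) (d n : nat) (f1 f2 : Rsp R d -> 'rV[R]_n) (Q : cube R d).
Hypotheses (d_gt0 : (0 < d)%N) (f1i : L1vec f1) (f2i : L1vec f2) (Q_gt0 : 0 < side Q).

Lemma setprod_ge0 : (0 <= setprod (avg f1 Q) (avg f2 Q))%E.
Proof.
apply: ereal_sup_ubound; exists 0, 0; split; [exact: avg0|exact: avg0|].
by rewrite big1// => j _; rewrite mxE mul0r.
Qed.

Definition cube_mean (h : Rsp R d -> R) (A : cube R d) : R :=
  (vol A)^-1 * Rintegral (leb R d) (cubeset A) (fun x => `|h x|).

Lemma cube_mean_ge0 h A : 0 < side A -> 0 <= cube_mean h A.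
Proof.
move=> A0; rewrite mulr_ge0 ?invr_ge0 ?exprn_ge0 ?(ltW A0)//.
exact: Rintegral_ge0.
Qed.

(** The frame comes from [almost_auerbach] for [<f1>_Q], and [avg_sign] converts means of absolute
    values into values at points of the two bodies. The last bound holds because [3^-n v_i] lies in
    [<f1>_Q], so its pairing with a point of [<f2>_Q] competes in the supremum. *)
Lemma frame_exists : exists WU : 'M[R]_n * 'M[R]_n,
  [/\ forall k, avg f1 Q k -> k *m WU.1 *m WU.2 = k,
      forall i, cube_mean (fun x => (f1 x *m WU.1) ord0 i) Q <= 2 &
      forall i, (((3 ^+ n)^-1 * cube_mean (fun x => (f2 x *m WU.2^T) ord0 i) Q)%:E
                <= setprod (avg f1 Q) (avg f2 Q))%E].
Proof.
have [W [U [WU W2 U3]]] := almost_auerbach _ _ _ _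
  (fun k j => @avg_bound _ _ _ _ _ f1i Q_gt0 k j) (avg0 f1 Q) (avg_conv f1i (Q := Q)).
exists (W, U); split=> //= i.
  have [k Kk kE] := avg_sign Q d_gt0 f1i W i.
  by rewrite -[cube_mean _ _]kE; exact: le_trans (ler_norm _) (W2 _ _ Kk).
have [k Kk kE] := avg_sign Q d_gt0 f2i U^T i.
apply: ereal_sup_ubound; exists ((3 ^+ n)^-1 *: row i U), k; split=> //.
congr EFin; rewrite -[cube_mean _ _]kE mxE mulr_sumr; apply: eq_bigr => j _.
by rewrite !mxE; ring.
Qed.
End Setprod.

(** * Sparse families from stopping times *)

Lemma descendants_countable (R : realType) (d : nat) (P : cube R d) :
  countable [set A | exists k, descendant k A P].
Proof.
pose code (t : nat * {ffun 'I_d -> nat}) : cube R d :=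
  Cube (fun i => corner P i + (t.2 i)%:R * (side P / 2 ^+ t.1)) (side P / 2 ^+ t.1).
apply: (@sub_countable _ _ _ (code @` setT)); last first.
  by apply: (@sub_countable _ _ _ setT); [exact: card_image_le|exact: countableP].
apply: subset_card_le => A [k [sA /choice[m mP]]].
exists (k, [ffun i => m i]) => //; apply: cube_eq => //= i.
by have [_ ->] := mP i; rewrite ffunE sA.
Qed.

(** [H] acts as a density: each cube of [S] carries at least its own volume of it, and by
    disjointness the integrals add up to at most the integral over [P]. *)
Lemma disjoint_cubes_measure (R : realType) (d : nat) (P : cube R d) (S : set (cube R d))
    (H : Rsp R d -> R) :
  (0 < d)%N -> 0 < side P ->
  (leb R d).-integrable setT (EFin \o H) -> (forall x, 0 <= H x) ->
  (forall A, S A -> exists k, descendant k A P) ->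
  (forall A B x, S A -> S B -> cubeset A x -> cubeset B x -> A = B) ->
  (forall A, S A -> vol A <= Rintegral (leb R d) (cubeset A) H) ->
  measurable (\bigcup_(A in S) cubeset A) /\
  (leb R d (\bigcup_(A in S) cubeset A) <= (Rintegral (leb R d) (cubeset P) H)%:E)%E.
Proof.
move=> d_gt0 P_gt0 Hi H0 SP Sdisj SH.
have mQ A : measurable (cubeset A : set (Rsp R d)) by exact: measurable_cubeset.
have /countable_injP[g ginj] : countable S.
  exact: sub_countable (subset_card_le SP) (descendants_countable P).
(* The injection [g] turns [S] into a sequence of sets, empty at the integers that code no cube. *)
pose F (p : nat) : set (Rsp R d) := [set x | exists A, [/\ S A, g A = p & cubeset A x]].
have FE p : (exists A, S A /\ F p = cubeset A) \/ F p = set0.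
  have [[A [SA gA]]|h] := pselect (exists A, S A /\ g A = p).
    left; exists A; split=> //; apply/seteqP; split=> x; last by exists A.
    move=> [B [SB gB xB]].
    by have -> : A = B by apply: ginj; rewrite ?inE// gA gB.
  by right; apply/seteqP; split=> x // [A [SA gA _]]; apply: h; exists A.
have mF p : measurable (F p) by have [[A [_ ->]]|->] := FE p.
have UE : \bigcup_(A in S) cubeset A = \bigcup_p F p.
  apply/seteqP; split=> x; first by move=> [A SA xA]; exists (g A) => //; exists A.
  by move=> [p _ [A [SA _ xA]]]; exists A.
have tF : trivIset setT F.
  apply/trivIsetP => p q _ _ /eqP pq; apply/seteqP; split=> x // [].
  move=> [A [SA gA xA]] [B [SB gB xB]]; apply: pq.
  by rewrite -gA -gB (Sdisj _ _ _ SA SB xA xB).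
have mH : measurable_fun setT (EFin \o H) by exact: measurable_int Hi.
have mU : measurable (\bigcup_p F p) by exact: bigcup_measurable.
rewrite UE; split=> //.
have IE A : (\int[leb R d]_(x in cubeset A) (H x)%:E =
    (Rintegral (leb R d) (cubeset A) H)%:E)%E.
  rewrite fineK//; apply: integrable_fin_num => //.
  exact: (integrableS measurableT (mQ A) (@subsetT _ _) Hi).
rewrite [leLHS]measure_bigcup//.
apply: (@le_trans _ _ (\int[leb R d]_(x in \bigcup_p F p) (H x)%:E)%E).
  rewrite ge0_integral_bigcup//; last by move=> x _; rewrite lee_fin.
    2: exact: (measurable_funTS mH).
  rewrite [leLHS](@eq_eseriesl _ _ xpredT); last by move=> p; rewrite in_setT.
  apply: lee_nneseries => // p _.
  have [[A [SA ->]]|->] := FE p; last by rewrite measure0 integral_set0.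
  have A_gt0 : 0 < side A by have [k /descendant_side_gt0] := SP A SA; exact.
  by rewrite IE [leLHS]leb_cubeset// lee_fin SH.
rewrite -IE; apply: ge0_subset_integral => //.
- exact: (measurable_funTS mH).
- by move=> x _; rewrite lee_fin.
- move=> x [p _ [A [SA _ xA]]]; have [k kA] := SP A SA.
  exact: descendant_subset kA _ xA.
Qed.

Section SparseFamily.
Variables (R : realType) (d : nat) (D : set (cube R d)).
Variables (bad : cube R d -> cube R d -> Prop) (Q0 : cube R d).
Hypotheses (d_gt0 : (0 < d)%N) (D_dyadic : dyadic_lattice D) (DQ0 : D Q0).
Hypothesis bad_irrefl : forall P, D P -> ~ bad P P.
Hypothesis bad_small : forall P, D P -> exists H : Rsp R d -> R,
  [/\ (leb R d).-integrable setT (EFin \o H), forall x, 0 <= H x,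
      forall A k, descendant k A P -> bad P A -> vol A <= Rintegral (leb R d) (cubeset A) H &
      Rintegral (leb R d) (cubeset P) H <= vol P / 2].

Let desc (A B : cube R d) : Prop := exists k, descendant k A B.

Let desc_trans A B C : desc A B -> desc B C -> desc A C.
Proof. by move=> [k h] [l h']; exists (k + l)%N; exact: descendant_trans h h'. Qed.

Let desc_refl A : desc A A.
Proof. by exists 0%N; exact: descendant_refl. Qed.

Let desc_D A B : D B -> desc A B -> D A.
Proof. by move=> DB [k]; exact: dyadic_descendant. Qed.

Let desc_sub A B : D B -> desc A B -> cubeset A `<=` cubeset B.
Proof.
move=> DB [k]; apply: descendant_subset; exact: dyadic_side_gt0 DB.
Qed.

Let stop (P A : cube R d) : Prop :=
  [/\ desc A P, bad P A & forall B, desc A B -> desc B P -> bad P B -> B = A].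

Let stop_D P A : D P -> stop P A -> D A.
Proof. by move=> DP [h _ _]; exact: desc_D h. Qed.

Let stop_disj P A B x : D P -> stop P A -> stop P B -> cubeset A x -> cubeset B x -> A = B.
Proof.
move=> DP sA sB xA xB; have DA := stop_D DP sA; have DB := stop_D DP sB.
have [AP bA mA] := sA; have [BP bB mB] := sB.
have [AB|/ltW BA] := lerP (side A) (side B).
  by apply/esym/mA => //; exact: (dyadic_meet D_dyadic DA DB xA xB AB).
by apply: mB => //; exact: (dyadic_meet D_dyadic DB DA xB xA BA).
Qed.

Let descendant_level k j l A B C : D C -> descendant k A C -> descendant j A B ->
  descendant l B C -> k = (j + l)%N.
Proof.
move=> DC [sk _] [sj _] [sl _]; have C0 := dyadic_side_gt0 D_dyadic DC.
move: sk; rewrite sj sl -mulrA -invfM -exprD => /(mulfI (lt0r_neq0 C0))/invr_inj.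
by rewrite -!natrX => /eqP; rewrite eqr_nat eqn_exp2l// => /eqP <-; rewrite addnC.
Qed.

(** Only finitely many generations separate [A] from [P]; moving to a strictly larger bad cube as
    long as there is one ends at a maximal one. *)
Let bad_stop P A : D P -> desc A P -> bad P A -> exists2 B, stop P B & desc A B.
Proof.
move=> DP [k]; elim/ltn_ind: k A => k IH A kA bA.
have [h|] := pselect (forall B, desc A B -> desc B P -> bad P B -> B = A).
  by exists A => //; split=> //; exists k.
move=> /existsNP[B /not_implyP[[j AB] /not_implyP[[l BP] /not_implyP[bB BA]]]].
have kE := descendant_level DP kA AB BP.
have [|C sC BC] := IH l _ B BP bB.
  rewrite kE; case: j AB {kE} => [|j] AB; last by rewrite addSn ltnS leq_addl.
  by case: BA; rewrite (descendant0 AB).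
by exists C => //; apply: desc_trans BC; exists j.
Qed.

Fixpoint selected (k : nat) (A : cube R d) : Prop :=
  match k with
  | 0 => A = Q0
  | k.+1 => exists2 P, selected k P & stop P A
  end.

Definition sparse_family : set (cube R d) := [set A | exists k, selected k A].

Let selected_D k A : selected k A -> D A.
Proof.
by elim: k A => [|k IH] A /=; [move=> ->|move=> [P /IH DP /(stop_D DP)]].
Qed.

Let selected_disj k A B x : selected k A -> selected k B ->
  cubeset A x -> cubeset B x -> A = B.
Proof.
elim: k A B => [|k IH] A B /=; first by move=> -> ->.
move=> [P sP PA] [P' sP' PB] xA xB.
have DP := selected_D sP; have DP' := selected_D sP'.
have e : P = P'.
  apply: IH => //; [apply: (desc_sub DP _ xA); by case: PA|].
  by apply: (desc_sub DP' _ xB); case: PB.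
by rewrite -e in PB; exact: (stop_disj DP PA PB xA xB).
Qed.

Let selected_above j k A : (j < k)%N -> selected k A ->
  exists P B, [/\ selected j P, stop P B & cubeset A `<=` cubeset B].
Proof.
elim: k A => // k IH A; rewrite ltnS leq_eqVlt => /predU1P[->|jk] /= [P sP PA].
  by exists P, A; split.
have [P' [B [sP' P'B PB]]] := IH P jk sP.
exists P', B; split=> //; apply: subset_trans PB.
by apply: (desc_sub (selected_D sP)); case: PA.
Qed.

Lemma sparse_family_sub : sparse_family `<=` D.
Proof. by move=> A [k]; exact: selected_D. Qed.

Lemma sparse_family_root : sparse_family Q0.
Proof. by exists 0%N. Qed.

(** [E_P] is [P] minus its stopping cubes, which by [bad_small] fill at most half of [P]. *)
Lemma sparse_family_sparse : sparse (2^-1) sparse_family.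
Proof.
pose U P := \bigcup_(A in stop P) cubeset A : set (Rsp R d).
exists (fun P => cubeset P `\` U P); split=> [P SP|].
  have DP := sparse_family_sub SP; have P_gt0 := dyadic_side_gt0 D_dyadic DP.
  have [H [Hi H0 HA HP]] := bad_small DP.
  have [|||mU U2] := @disjoint_cubes_measure _ _ P (stop P) H d_gt0 P_gt0 Hi H0.
  - by move=> A [].
  - by move=> A B x sA sB; exact: (stop_disj DP sA sB).
  - by move=> A [[k kA] bA _]; exact: HA kA bA.
  have mP : measurable (cubeset P : set (Rsp R d)) by exact: measurable_cubeset.
  split; [exact: measurableD|by move=> x []|].
  have UP : cubeset P `&` U P = U P.
    apply/setIidPr => x [A [AP _ _] xA]; exact: (desc_sub DP AP xA).
  rewrite [leRHS]measureD//; last by rewrite [ltLHS]leb_cubeset// ltey.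
  rewrite UP leeBrDr; last first.
    by rewrite ge0_fin_numE//; apply: le_lt_trans U2 _; rewrite ltey.
  rewrite [leRHS]leb_cubeset//; apply: (@le_trans _ _ ((vol P / 2)%:E + (vol P / 2)%:E)%E).
    apply: leeD; first by rewrite lee_fin mulrC.
    by apply: le_trans U2 _; rewrite lee_fin.
  by rewrite -EFinD lee_fin; lra.
move=> P P' [j jP] [k kP] PP'.
(* A cube selected at a later generation lies in a stopping cube of its ancestor of generation [a];
   if it meets [A], this ancestor is [A], and the set [U A] has removed it. *)
have key (a b : nat) A B x : (a < b)%N -> selected a A -> selected b B ->
    cubeset A x -> ~ U A x -> cubeset B x -> False.
  move=> ab aA bB xA nU xB; have [A' [C [aA' sC BC]]] := selected_above ab bB.
  have DA' := selected_D aA'; have xC := BC _ xB.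
  have xA' : cubeset A' x by apply: (desc_sub DA' _ xC); case: sC.
  have e := selected_disj aA aA' xA xA'.
  by apply: nU; exists C => //; rewrite e.
apply/seteqP; split=> x // -[[xP nP] [xP' nP']].
have [jk|kj|jk] := ltngtP j k.
- exact: (key _ _ _ _ x jk jP kP).
- exact: (key _ _ _ _ x kj kP jP).
- by apply: PP'; move: kP; rewrite -jk => kP; exact: (selected_disj jP kP xP xP').
Qed.

(** If some cube between [Q] and the selected [P] is bad, the stopping cube around it is selected
    too and strictly closer to [Q]; the search ends by induction on the number of generations. *)
Lemma sparse_family_minimal Q : desc Q Q0 -> exists P,
  [/\ sparse_family P, desc Q P & forall A, desc Q A -> desc A P -> ~ bad P A].
Proof.
suff H k P : sparse_family P -> descendant k Q P -> exists P,
  [/\ sparse_family P, desc Q P & forall A, desc Q A -> desc A P -> ~ bad P A].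
  by move=> [k]; apply: H; exact: sparse_family_root.
elim/ltn_ind: k P => k IH P SP kQ.
have [h|] := pselect (forall A, desc Q A -> desc A P -> ~ bad P A).
  by exists P; split=> //; exists k.
move=> /existsNP[A /not_implyP[QA /not_implyP[AP /contrapT bA]]].
have DP := sparse_family_sub SP.
have [B sB AB] := bad_stop DP AP bA.
have [l QB] := desc_trans QA AB.
have [[j BP] bB _] := sB.
apply: (IH l _ B _ QB).
  rewrite (descendant_level DP kQ QB BP).
  case: j BP => [|j] BP; last by rewrite addnS ltnS leq_addr.
  by move: bB; rewrite (descendant0 BP) => /bad_irrefl -/(_ DP).
by have [m mP] := SP; exists m.+1; exists P.
Qed.
End SparseFamily.

(** * Domination *)

Lemma cube_mean_vol (R : realType) (d : nat) (h : Rsp R d -> R) (A : cube R d) :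
  0 < side A ->
  cube_mean h A * vol A = Rintegral (leb R d) (cubeset A) (fun x => `|h x|).
Proof. by move=> A0; rewrite /cube_mean mulrC mulVKf// gt_eqF// vol_gt0. Qed.

(** * The stopping condition and its exceptional set *)

Section BadCubes.
Variables (R : realType) (d : nat) (J : finType) (h : J -> Rsp R d -> R) (P : cube R d).
Hypotheses (d_gt0 : (0 < d)%N) (P_gt0 : 0 < side P).
Hypothesis hi : forall t, (leb R d).-integrable setT (EFin \o h t).

(** For the [2n] frame coordinates this is [8n + 1]. The added [1] keeps it at least [1] for empty
    [J] too, so that a cube is never bad relative to itself. *)
Definition bad_threshold : R := (4 * #|J| + 1)%:R.

Lemma bad_threshold_ge1 : 1 <= bad_threshold.
Proof. by rewrite /bad_threshold ler1n addn1. Qed.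

Definition bad_cube (A : cube R d) : Prop := exists t : J,
  bad_threshold * cube_mean (h t) P * vol A <
  Rintegral (leb R d) (cubeset A) (fun x => `|h t x|).

Lemma bad_cube_irrefl : ~ bad_cube P.
Proof.
move=> [t]; rewrite -mulrA cube_mean_vol//; apply/negP; rewrite -leNgt.
by rewrite ler_peMl ?bad_threshold_ge1//; exact: Rintegral_ge0.
Qed.

(** [H] is the sum of the [|h t|], each divided by the threshold times its mean on [P]. On a bad
    cube one summand already integrates to at least the volume, while over [P] each summand
    contributes at most [vol P / bad_threshold]. *)
Lemma bad_cube_small : exists H : Rsp R d -> R,
  [/\ (leb R d).-integrable setT (EFin \o H), forall x, 0 <= H x,
      forall A k, descendant k A P -> bad_cube A ->
        vol A <= Rintegral (leb R d) (cubeset A) H &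
      Rintegral (leb R d) (cubeset P) H <= vol P / 2].
Proof.
have mQ A : measurable (cubeset A : set (Rsp R d)) by exact: measurable_cubeset.
pose K := bad_threshold; have K1 : 1 <= K := bad_threshold_ge1.
have K0 : 0 < K by apply: lt_le_trans K1.
pose a t := K^-1 * (cube_mean (h t) P)^-1.
have m0 t : 0 <= cube_mean (h t) P by exact: cube_mean_ge0.
have a0 t : 0 <= a t by rewrite mulr_ge0 ?invr_ge0// ltW.
have ahi t : (leb R d).-integrable setT (EFin \o (fun x => a t * `|h t x|)).
  by have := integrableZl measurableT (a t) (integrable_norm (hi t)); apply: eq_integrable.
pose H x := \sum_t a t * `|h t x|.
have IE A : Rintegral (leb R d) (cubeset A) H =
    \sum_t a t * Rintegral (leb R d) (cubeset A) (fun x => `|h t x|).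
  rewrite Rintegral_sum//; last first.
    by move=> t; exact: (integrableS measurableT (mQ A) (@subsetT _ _) (ahi t)).
  apply: eq_bigr => t _; rewrite RintegralZl//.
  exact: (integrableS measurableT (mQ A) (@subsetT _ _) (integrable_norm (hi t))).
exists H; split.
- rewrite (_ : _ \o _ = fun x => (\sum_t (EFin \o (fun x => a t * `|h t x|)%R) x)%E).
    by apply: integrable_sum => // t _; exact: ahi.
  by apply/funext => x; rewrite /= sumEFin.
- by move=> x; apply: sumr_ge0 => t _; rewrite mulr_ge0.
- move=> A k kA [t bt].
  have A_gt0 := descendant_side_gt0 P_gt0 kA.
  have vA := vol_gt0 A_gt0; have vP := vol_gt0 P_gt0.
  (* The inverse of a zero mean is [0], which would lose this summand; but then [|h t|] has zero
     integral over every subcube and none is bad for [t]. *)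
  have [m_eq0|m_neq0] := eqVneq (cube_mean (h t) P) 0.
    move: bt; rewrite m_eq0 mulr0 mul0r ltNge => /negP[].
    rewrite -(mul0r (vol P)) -m_eq0 cube_mean_vol//.
    by apply: Rintegral_norm_subset => //; exact: descendant_subset kA.
  have mt : 0 < cube_mean (h t) P by rewrite lt0r m_neq0 m0.
  rewrite IE (bigD1 t)//=; apply: ler_wpDr.
    by apply: sumr_ge0 => t' _; rewrite mulr_ge0//; exact: Rintegral_ge0.
  have Km : 0 < K * cube_mean (h t) P by rewrite mulr_gt0.
  by rewrite /a -invfM [leRHS]mulrC (ler_pdivlMr _ _ Km) [leLHS]mulrC; exact: ltW.
- rewrite IE; have vP := vol_gt0 P_gt0.
  apply: (@le_trans _ _ (\sum_(t : J) K^-1 * vol P)).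
    apply: ler_sum => t _; rewrite -cube_mean_vol// /a -mulrA ler_pM2l ?invr_gt0//.
    have [->|mt] := eqVneq (cube_mean (h t) P) 0; first by rewrite mul0r mulr0 ltW.
    by rewrite mulKf.
  rewrite sumr_const -[X in X <= _]mulr_natl mulrA [leRHS]mulrC ler_pM2r//.
  rewrite ler_pdivrMr// /K /bad_threshold natrD natrM.
  have : 0 <= #|J|%:R :> R by []. 
  lra.
Qed.
End BadCubes.

Lemma Rintegral_norm_restrict (R : realType) (d : nat) (h : Rsp R d -> R)
    (A : set (Rsp R d)) (P : cube R d) :
  Rintegral (leb R d) A (fun x => `|(x \in cubeset P)%:R * h x|) =
  Rintegral (leb R d) (A `&` cubeset P) (fun x => `|h x|).
Proof.
rewrite Rintegral_mkcondr restrict_indic; apply: eq_Rintegral => x _.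
by rewrite normrM [RHS]mulrC normr_nat.
Qed.

(** * The estimate for the cubes attached to one selected cube *)

Section LocalEstimate.
Variables (R : realType) (d n : nat) (D : set (cube R d)) (m1 m2 : nat).
Variable s : cube R d -> Rsp R d -> Rsp R d -> R.
Variables (f1 f2 : Rsp R d -> 'rV[R]_n) (P : cube R d) (W U : 'M[R]_n).
Hypotheses (d_gt0 : (0 < d)%N) (D_dyadic : dyadic_lattice D) (DP : D P).
Hypothesis s_shift : dyadic_shift D m1 m2 s.
Hypotheses (f1i : L1vec f1) (f2i : L1vec f2).

(* The coordinates of [f1] and [f2] in dual frames, so that
   [f1 . f2 = \sum_i frame_coord (true, i) * frame_coord (false, i)] on [P]. *)
Definition frame_coord (t : bool * 'I_n) (x : Rsp R d) : R :=
  if t.1 then (f1 x *m W) ord0 t.2 else (f2 x *m U^T) ord0 t.2.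

Lemma integrable_frame_coord t : (leb R d).-integrable setT (EFin \o frame_coord t).
Proof. by case: t => -[] i; exact: integrable_mulmx. Qed.

Hypothesis WU : forall k, avg f1 P k -> k *m W *m U = k.
Hypothesis F_le2 : forall i, cube_mean (frame_coord (true, i)) P <= 2.
Hypothesis G_le : forall i,
  (((3 ^+ n)^-1 * cube_mean (frame_coord (false, i)) P)%:E
     <= setprod (avg f1 P) (avg f2 P))%E.

(** Truncating [f1] and [f2] to [P] does not change the form, and [shift_block_bound] applies with
    the threshold times the means on [P]. The constant collects [n] coordinates, the squared
    threshold, and the factors [2] and [3 ^+ n] of the frame. *)
Lemma local_shift_bound (T : seq (cube R d)) :
  uniq T -> (forall Q, Q \in T -> D Q) ->
  (forall Q, Q \in T -> cubeset Q `<=` cubeset P \/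
     forall x, ~ cubeset P x -> f1 x = 0 /\ f2 x = 0) ->
  (forall Q A k l, Q \in T -> descendant k Q A -> descendant l A P ->
     ~ bad_cube frame_coord P A) ->
  ((`|\sum_j \sum_(Q <- T) shift_term s Q (fun x => f1 x ord0 j) (fun x => f2 x ord0 j)|)%:E
   <= ((2 ^ d + 2 * m1 + 2 * 2 ^ d * m2)%:R *
        (n%:R * (2 * (8 * n%:R + 1) ^+ 2 * 3 ^+ n)))%:E *
      ((vol P)%:E * setprod (avg f1 P) (avg f2 P)))%E.
Proof.
move=> T_uniq TD TP Tbad.
have P_gt0 : 0 < side P by exact: dyadic_side_gt0 DP.
have vP := vol_gt0 P_gt0.
have mQ A : measurable (cubeset A : set (Rsp R d)) by exact: measurable_cubeset.
pose K := bad_threshold R (bool * 'I_n)%type.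
have KE : K = 8 * n%:R + 1.
  rewrite /K /bad_threshold card_prod card_bool card_ord natrD !natrM; ring.
have K1 : 1 <= K := bad_threshold_ge1 _ _.
have K0 : 0 < K by apply: lt_le_trans K1.
pose m t := cube_mean (frame_coord t) P.
have m0 t : 0 <= m t by exact: cube_mean_ge0.
have Km0 t : 0 <= K * m t by exact: mulr_ge0 (ltW K0) (m0 t).
pose f1P x := (x \in cubeset P)%:R *: f1 x.
pose f2P x := (x \in cubeset P)%:R *: f2 x.
have resi (f : Rsp R d -> 'rV[R]_n) : L1vec f ->
    L1vec (fun x => (x \in cubeset P)%:R *: f x).
  move=> fi j; have := integrable_EFin_restrict _ _ _ _ (cubeset P)
    (fun x => f x ord0 j) (mQ P) (fi j).
  by apply: eq_integrable => // x _; rewrite /= restrict_indic mxE mulrC.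
have hP t A Q k : D A -> Q \in T -> descendant k Q A ->
    Rintegral (leb R d) (cubeset A) (fun x => `|(x \in cubeset P)%:R * frame_coord t x|)
    <= K * m t * vol A.
  move=> DA QT QA; rewrite Rintegral_norm_restrict.
  have A_gt0 : 0 < side A by exact: dyadic_side_gt0 DA.
  have vA := vol_gt0 A_gt0.
  (* Three cases: [A] misses [P] and the integral is zero; [A] lies in [P] and is not bad; or [A] is
     larger than [P]. *)
  have [[x [xA xP]]|disj] := pselect (exists x, cubeset A x /\ cubeset P x); last first.
    have -> : cubeset A `&` cubeset P = set0.
      by apply/seteqP; split=> x // [xA xP]; apply: disj; exists x.
    by rewrite Rintegral_set0 (mulr_ge0 (Km0 t) (ltW vA)).
  have [AP|PA] := lerP (side A) (side P).
    have [l lA] := dyadic_meet D_dyadic DA DP xA xP AP.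
    have nb := Tbad _ _ _ _ QT QA lA.
    apply: (@le_trans _ _ (Rintegral (leb R d) (cubeset A) (fun x => `|frame_coord t x|))).
      apply: Rintegral_norm_subset => //; [exact: measurableI|exact: integrable_frame_coord].
    by rewrite leNgt; apply/negP => lt; apply: nb; exists t.
  (* For [A] larger than [P] all the mass sits in [P], and [vol P <= vol A]. *)
  apply: (@le_trans _ _ (Rintegral (leb R d) (cubeset P) (fun x => `|frame_coord t x|))).
    apply: Rintegral_norm_subset => //; [exact: measurableI|exact: integrable_frame_coord].
  rewrite -cube_mean_vol// -mulrA -/(m t) -[leLHS]mul1r.
  apply: ler_pM => //; first exact: mulr_ge0 (m0 t) (ltW vP).
  by rewrite ler_wpM2l// lerXn2r// ?nnegrE ltW.
have hT t : Rintegral (leb R d) setT (fun x => `|(x \in cubeset P)%:R * frame_coord t x|)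
    <= K * m t * vol P.
  rewrite Rintegral_norm_restrict setTI -cube_mean_vol// -/(m t).
  by rewrite ler_pM2r// ler_peMl.
have f1PE i x : (f1P x *m W) ord0 i = (x \in cubeset P)%:R * frame_coord (true, i) x.
  by rewrite /f1P -scalemxAl mxE.
have f2PE i x : (f2P x *m U^T) ord0 i = (x \in cubeset P)%:R * frame_coord (false, i) x.
  by rewrite /f2P -scalemxAl mxE.
have -> : \sum_j \sum_(Q <- T) shift_term s Q (fun x => f1 x ord0 j) (fun x => f2 x ord0 j) =
    \sum_j \sum_(Q <- T) shift_term s Q (fun x => f1P x ord0 j) (fun x => f2P x ord0 j).
  apply: eq_bigr => j _; rewrite big_seq [RHS]big_seq; apply: eq_bigr => Q QT.
  apply: eq_Rintegral => -[x y]; rewrite in_setX /= => /andP[/set_mem xQ /set_mem yQ].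
  have e z : cubeset Q z -> f1P z = f1 z /\ f2P z = f2 z.
    move=> zQ; rewrite /f1P /f2P.
    have [_|/negP zP] := boolP (z \in cubeset P); first by rewrite !scale1r.
    have nP : ~ cubeset P z by move/mem_set.
    by case: (TP _ QT) => [/(_ _ zQ)//|/(_ _ nP)[-> ->]]; rewrite !scaler0.
  by have [-> _] := e x xQ; have [_ ->] := e y yQ.
have bound := shift_block_bound d_gt0 D_dyadic s_shift T_uniq TD (resi _ f1i) (resi _ f2i)
  (W := W) (U := U) (F := fun i => K * m (true, i)) (G := fun i => K * m (false, i))
  (V := vol P).
apply: (@le_trans _ _ ((2 ^ d + 2 * m1 + 2 * 2 ^ d * m2)%:R *
    \sum_i (K * m (true, i) * (K * m (false, i)) * vol P))%:E).
  rewrite lee_fin; apply: bound.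
  (* The integral of the truncated [f1] over [A], divided by [vol P], lies in [<f1>_P]; the scalar
     then cancels. *)
  - move=> A DA /=; have := WU (avg_subset f1 P d_gt0 (mQ A)).
    rewrite -!scalemxAl => /(scalerI _); apply.
    by rewrite invr_eq0 gt_eqF.
  - by move=> i; exact: Km0.
  - by move=> i; exact: Km0.
  - exact: ltW.
  - move=> i A Q k DA QT QA; split.
      under eq_Rintegral do rewrite f1PE; exact: (hP (true, i) A Q k).
    under eq_Rintegral do rewrite f2PE; exact: (hP (false, i) A Q k).
  - by move=> i; under eq_Rintegral do rewrite f1PE; exact: (hT (true, i)).
  - by move=> i; under eq_Rintegral do rewrite f2PE; exact: (hT (false, i)).
set X := setprod _ _.
rewrite [X in (X <= _)%E]EFinM [X in (_ <= X * _)%E]EFinM -muleA; apply: lee_wpmul2l; first by rewrite lee_fin.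
rewrite -sumEFin; apply: (@le_trans _ _ (\sum_(i < n)
    (2 * (8 * n%:R + 1) ^+ 2 * 3 ^+ n)%:E * ((vol P)%:E * X))%E).
  apply: lee_sum => i _.
  apply: (@le_trans _ _ ((2 * K ^+ 2 * 3 ^+ n * vol P)%:E *
     ((3 ^+ n)^-1 * m (false, i))%:E)%E).
    rewrite -EFinM lee_fin.
    have -> : 2 * K ^+ 2 * 3 ^+ n * vol P * ((3 ^+ n)^-1 * m (false, i)) =
        2 * (K ^+ 2 * vol P * m (false, i)).
      by field; rewrite expf_neq0.
    have -> : K * m (true, i) * (K * m (false, i)) * vol P =
        m (true, i) * (K ^+ 2 * vol P * m (false, i)) by ring.
    rewrite ler_wpM2r ?F_le2//.
    by apply: mulr_ge0 (m0 _); apply: mulr_ge0 (ltW vP); exact: exprn_ge0 (ltW K0).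
  rewrite -KE muleA -(EFinM _ (vol P)); apply: lee_wpmul2l; last exact: G_le.
  rewrite lee_fin; apply: mulr_ge0 (ltW vP); apply: mulr_ge0; last exact: exprn_ge0.
  by apply: mulr_ge0 => //; exact: exprn_ge0 (ltW K0).
rewrite -ge0_sume_distrl => [|i _]; last by rewrite lee_fin !mulr_ge0 ?exprn_ge0 ?addr_ge0 ?mulr_ge0.
by rewrite sumEFin sumr_const card_ord -[X in (X%:E * _ <= _)%E]mulr_natl.
Qed.
End LocalEstimate.

Lemma partition_big_undup (V : nmodType) (I J : eqType) (r : seq I) (p : I -> J) (F : I -> V) :
  \sum_(i <- r) F i = \sum_(j <- undup (map p r)) \sum_(i <- r | p i == j) F i.
Proof.
rewrite (exchange_big_dep predT)//= big_seq [RHS]big_seq; apply: eq_bigr => i ir.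
rewrite (big_rem (p i)) /=; last by rewrite mem_undup map_f.
rewrite eqxx big_seq_cond big1 ?addr0// => j /andP[+ /eqP e].
by rewrite mem_rem_uniq ?undup_uniq// !inE e eqxx.
Qed.

Lemma support_in_cube (R : realType) (d n : nat) (f1 f2 : Rsp R d -> 'rV[R]_n)
    (D : set (cube R d)) :
  compact_support f1 -> compact_support f2 -> dyadic_lattice D ->
  exists Q, D Q /\ forall x, ~ cubeset Q x -> f1 x = 0 /\ f2 x = 0.
Proof.
move=> [K1 [cK1 fK1]] [K2 [cK2 fK2]] [_ _ _ /(_ _ (compactU cK1 cK2))[Q [DQ KQ]]].
exists Q; split=> // x xQ.
have nQ : ~ cubeV Q (rowv x) by move=> h; apply: xQ => i; have := h i; rewrite mxE.
split; apply/eqP; apply: contraT => fx; case: nQ; apply: KQ.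
  by left; exact: fK1.
by right; exact: fK2.
Qed.

(** By (A1) only finitely many kernels are nonzero somewhere on their cube; [T] lists these cubes
    and the others contribute zero. *)
Lemma shift_form_vecE (R : realType) (d n m1 m2 : nat) (D : set (cube R d))
    (s : cube R d -> Rsp R d -> Rsp R d -> R) :
  dyadic_shift D m1 m2 s -> exists T : seq (cube R d),
  [/\ uniq T, forall Q, Q \in T -> D Q &
   forall f1 f2 : Rsp R d -> 'rV[R]_n, shift_form_vec D s f1 f2 =
   \sum_j \sum_(Q <- T) shift_term s Q (fun x => f1 x ord0 j) (fun x => f2 x ord0 j)].
Proof.
move=> [[fin _] _ _]; set S := [set Q | _] in fin.
exists (finmap.enum_fset (fset_set S)); split=> [|Q|f1 f2]; first exact: finmap.fset_uniq.
  by rewrite in_fset_set// inE => -[].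
apply: eq_bigr => j _; rewrite -fsbig_finite// /shift_form.
apply/esym/fsbig_widen => [Q []//|Q [DQ nS]] /=.
rewrite [LHS](_ : _ = Rintegral (prodSF (leb R d) (leb R d)) (cubeset Q `*` cubeset Q) (cst 0)).
  by rewrite /Rintegral /cst integral0.
apply: eq_Rintegral => -[x y]; rewrite in_setX /= => /andP[/set_mem xQ /set_mem yQ].
have [->|h] := eqVneq (s Q x y) 0; first by rewrite !mul0r.
by case: nS; split=> //; exists x, y.
Qed.

Theorem theorem3p1 (R : realType) (d n : nat) (hd : (0 < d)%N) :
  exists eta : R, 0 < eta < 1 /\
  exists C : R,
  forall f1 f2 : Rsp R d -> 'rV[R]_n,
    L1vec f1 -> L1vec f2 -> compact_support f1 -> compact_support f2 ->
  forall D : set (cube R d), dyadic_lattice D ->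
  exists S : set (cube R d), S `<=` D /\ sparse eta S /\
    forall rho : nat, (1 <= rho)%N ->
    forall s : cube R d -> Rsp R d -> Rsp R d -> R,
      shift_of_complexity D rho s ->
      ((`|shift_form_vec D s f1 f2|)%:E
        <= (C * rho%:R)%:E *
           \esum_(Q in S) ((vol Q)%:E * setprod (avg f1 Q) (avg f2 Q)))%E.
Proof.
exists 2^-1; split; first by lra.
pose Cn : R := n%:R * (2 * (8 * n%:R + 1) ^+ 2 * 3 ^+ n).
have Cn0 : 0 <= Cn by rewrite !mulr_ge0 ?exprn_ge0 ?addr_ge0 ?mulr_ge0.
(* The [5] bounds [2 ^ d + 2 * m1 + 2 * 2 ^ d * m2] by [5 * 2 ^ d * rho], as [m1], [m2] and [1] are
   at most [rho]. *)
exists ((5 * 2 ^ d)%:R * Cn) => f1 f2 f1i f2i sf1 sf2 D D_dyadic.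
have [Q0 [DQ0 supp]] := support_in_cube sf1 sf2 D_dyadic.
have /choice[fr frP] : forall P, exists WU : 'M[R]_n * 'M[R]_n, D P ->
  [/\ forall k, avg f1 P k -> k *m WU.1 *m WU.2 = k,
      forall i, cube_mean (fun x => (f1 x *m WU.1) ord0 i) P <= 2 &
      forall i, (((3 ^+ n)^-1 * cube_mean (fun x => (f2 x *m WU.2^T) ord0 i) P)%:E
                <= setprod (avg f1 P) (avg f2 P))%E].
  move=> P; have [DP|nDP] := pselect (D P); last by exists (0, 0).
  have [WU WUP] := frame_exists hd f1i f2i (dyadic_side_gt0 D_dyadic DP).
  by exists WU.
pose h P := frame_coord f1 f2 (fr P).1 (fr P).2.
(* Each cube has its own frame and hence its own test functions, so badness relates two cubes. Only
   [f1] and [f2] enter, so the sparse family is fixed before the shift. *)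
pose bad P := bad_cube (h P) P.
have hi P t : (leb R d).-integrable setT (EFin \o h P t).
  exact: integrable_frame_coord.
have bad_irr P : D P -> ~ bad P P.
  by move=> DP; apply: bad_cube_irrefl; exact: dyadic_side_gt0 DP.
have bad_sm P : D P -> exists H : Rsp R d -> R,
  [/\ (leb R d).-integrable setT (EFin \o H), forall x, 0 <= H x,
      forall A k, descendant k A P -> bad P A -> vol A <= Rintegral (leb R d) (cubeset A) H &
      Rintegral (leb R d) (cubeset P) H <= vol P / 2].
  move=> DP; exact: (bad_cube_small hd (dyadic_side_gt0 D_dyadic DP) (hi P)).
pose S := sparse_family bad Q0.
have SD : S `<=` D by exact: sparse_family_sub.
exists S; split=> //; split; first exact: (sparse_family_sparse hd D_dyadic DQ0 bad_sm).
move=> rho rho1 s [m1 [m2 [mE shift_s]]].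
have [T [T_uniq TD ->]] := shift_form_vecE n shift_s.
(* A cube inside [Q0] goes to a selected cube with no bad cube in between; every other cube goes to
   [Q0], which contains both supports. *)
have /choice[pi piP] : forall Q, exists P, S P /\
    ((exists k, descendant k Q Q0) -> (exists k, descendant k Q P) /\
      forall A, (exists k, descendant k Q A) -> (exists k, descendant k A P) -> ~ bad P A) /\
    (~ (exists k, descendant k Q Q0) -> P = Q0).
  move=> Q; have [QQ0|nQ] := pselect (exists k, descendant k Q Q0).
    have [P [SP QP nb]] := sparse_family_minimal D_dyadic DQ0 bad_irr QQ0.
    by exists P; split.
  by exists Q0; split; first exact: sparse_family_root.
pose val P := ((vol P)%:E * setprod (avg f1 P) (avg f2 P))%E.
have val0 P : D P -> (0 <= val P)%E.
  move=> DP; apply: mule_ge0; last exact: setprod_ge0.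
  by rewrite lee_fin ltW// vol_gt0//; exact: dyadic_side_gt0 DP.
pose term P := \sum_(j < n) \sum_(Q <- [seq Q <- T | pi Q == P])
  shift_term s Q (fun x => f1 x ord0 j) (fun x => f2 x ord0 j).
pose Ps := undup (map pi T).
have PsS P : P \in Ps -> S P.
  by rewrite mem_undup => /mapP[Q _ ->]; have [] := piP Q.
have -> : \sum_j \sum_(Q <- T) shift_term s Q (fun x => f1 x ord0 j) (fun x => f2 x ord0 j) =
    \sum_(P <- Ps) term P.
  rewrite /term [RHS]exchange_big/=; apply: eq_bigr => j _.
  by rewrite (partition_big_undup _ pi); apply: eq_bigr => P _; rewrite big_filter.
have termP P : P \in Ps ->
    ((`|term P|)%:E <= ((5 * 2 ^ d)%:R * Cn * rho%:R)%:E * val P)%E.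
  move=> PPs; have SP := PsS _ PPs; have DP := SD _ SP.
  have [WU F2 GX] := frP P DP.
  apply: (@le_trans _ _ (((2 ^ d + 2 * m1 + 2 * 2 ^ d * m2)%:R * Cn)%:E * val P)%E).
    apply: (local_shift_bound hd D_dyadic DP shift_s f1i f2i (W := (fr P).1) (U := (fr P).2)).
    - exact: WU.
    - exact: F2.
    - exact: GX.
    - exact: filter_uniq.
    - by move=> Q; rewrite mem_filter => /andP[_ /TD].
    - move=> Q; rewrite mem_filter => /andP[/eqP piQ _].
      have [_ [h1 h2]] := piP Q; rewrite piQ in h1 h2.
      have [QQ0|nQ] := pselect (exists k, descendant k Q Q0).
        have [[k kP] _] := h1 QQ0; left.
        exact: descendant_subset (dyadic_side_gt0 D_dyadic DP) kP.
      by right; rewrite (h2 nQ).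
    - move=> Q A k l; rewrite mem_filter => /andP[/eqP piQ _] QA AP.
      have [_ [h1 h2]] := piP Q; rewrite piQ in h1 h2.
      have [QQ0|nQ] := pselect (exists k, descendant k Q Q0).
        by have [_ nb] := h1 QQ0; apply: nb; [exists k|exists l].
      case: (nQ); rewrite -(h2 nQ); exists (k + l)%N; exact: descendant_trans QA AP.
  apply: lee_wpmul2r; first exact: val0.
  rewrite lee_fin mulrAC ler_wpM2r// -natrM ler_nat.
  have e0 : (0 < 2 ^ d)%N by rewrite expn_gt0.
  have m1r : (m1 <= rho)%N by rewrite -mE !leq_max leqnn orbT.
  have m2r : (m2 <= rho)%N by rewrite -mE !leq_max leqnn !orbT.
  by move: (2 ^ d)%N e0 => e e0; nia.
apply: (@le_trans _ _ (\sum_(P <- Ps) ((5 * 2 ^ d)%:R * Cn * rho%:R)%:E * val P)%E).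
  apply: (@le_trans _ _ (\sum_(P <- Ps) (`|term P|)%:E)%E).
    by rewrite sumEFin lee_fin ler_norm_sum.
  by rewrite big_seq [leRHS]big_seq; apply: lee_sum => P; exact: termP.
rewrite big_seq -ge0_sume_distrr; last by move=> P /PsS/SD; exact: val0.
apply: lee_wpmul2l; first by rewrite lee_fin !mulr_ge0.
(* Only finitely many selected cubes receive a cube of the shift; their partial sum bounds the full
   sum from below. *)
apply: esum_ge; exists [set` Ps].
  by split; [exact: finite_seq|move=> P /= /PsS].
by rewrite -fsbig_seq ?undup_uniq// -big_seq.
Qed.
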